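(* Let $X$ be a completely regular space, $A$ a completely closed subset of $X$, and let $(\beta X,\beta A)$ be the pair of Stone–Čech compactifications of $X$ and $A$, where $\beta A$ is identified with the closure of $A$ in $\beta X$. Then for every integer $n$ and every abelian group $G$, $$\check{H}_n^F(X,A;G)\cong\check{H}_n(\beta X,\beta A;G)\qquad\text{and}\qquad \hat{H}_F^n(X,A;G)\cong\hat{H}^n(\beta X,\beta A;G).$$
   Context: Completely regular spaces are Tychonoff spaces. A subset $A\subset X$ is completely closed if it is closed and every continuous map $A\to[0,1]$ extends to a continuous map $X\to[0,1]$. A subset $U\subset X$ is functionally open if $U=f^{-1}((0,1])$ for some continuous $f:X\to[0,1]$. Let $cov_F(X)$ be the set of finite indexed covers $\alpha=\{\alpha_v\}_{v\in V_\alpha}$ of $X$ by functionally open sets, directed by refinement: $\alpha\le\alpha'$ iff every member of $\alpha'$ is contained in a member of $\alpha$. For $\alpha\in cov_F(X)$ the nerve $X_\alpha$ is the simplicial complex of nonempty finite $s\subset V_\alpha$ with $\bigcap_{v\in s}\alpha_v\neq\emptyset$, and $A_\alpha\subset X_\alpha$ is the subcomplex of those $s$ with $A\cap\bigcap_{v\in s}\alpha_v\ne\emptyset$. $H_n(X_\alpha,A_\alpha;G)$ and $H^n(X_\alpha,A_\alpha;G)$ are the simplicial homology and cohomology groups with coefficients in $G$. For $\alpha\le\alpha'$ any refinement projection $p_{\alpha\alpha'}:V_{\alpha'}\to V_\alpha$ (with $\alpha'_{v}\subset\alpha_{p_{\alpha\alpha'}(v)}$) is a simplicial map $(X_{\alpha'},A_{\alpha'})\to(X_\alpha,A_\alpha)$;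 the induced homomorphisms $p_{\alpha\alpha'*}$ on homology and $p_{\alpha\alpha'}^*$ on cohomology do not depend on its choice. The functional homology and cohomology groups are $$\check H_n^F(X,A;G)=\varprojlim\{H_n(X_\alpha,A_\alpha;G),p_{\alpha\alpha'*},cov_F(X)\},\quad \hat H^n_F(X,A;G)=\varinjlim\{H^n(X_\alpha,A_\alpha;G),p^*_{\alpha\alpha'},cov_F(X)\}.$$ The groups $\check H_n(\beta X,\beta A;G)$ and $\hat H^n(\beta X,\beta A;G)$ are the usual Čech homology and cohomology groups of the compact pair $(\beta X,\beta A)$, defined by the same limits taken over all open covers of $\beta X$ (equivalently, over all finite open covers) in place of $cov_F$. *)

(* Defs.v *)
From HB Require Import structures.
From mathcomp Require Import all_boot all_order all_algebra.
From mathcomp Require Import all_classical all_reals all_analysis.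
From mathcomp Require Import finmap.
From mathcomp Require Import -(notations) monalg.

Set Implicit Arguments.
Unset Strict Implicit.
Unset Printing Implicit Defensive.

Import Order.TTheory GRing.Theory Num.Theory.
Import numFieldNormedType.Exports.

Local Open Scope classical_set_scope.
Local Open Scope ring_scope.

Section Zspan.
Variable V : zmodType.

(* The subgroup generated by S. *)
Definition zspan (S : set V) : {pred V} := fun x =>
  `[< forall H : zmodClosed V, (forall y, S y -> y \in H) -> x \in H >].

Lemma zspan_closed S : zmod_closed (zspan S).
Proof.
split=> [|x y /asboolP Sx /asboolP Sy]; apply/asboolP => H SH.
  exact: rpred0.
by rewrite rpredB ?Sx ?Sy.
Qed.

HB.instance Definition _ S :=
  GRing.isZmodClosed.Build V (zspan S) (zspan_closed S).

Lemma mem_zspan (S : set V) x : S x -> x \in zspan S.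
Proof. by move=> Sx; apply/asboolP => H; exact. Qed.

End Zspan.

Lemma zspan_map (V W : zmodType) (h : {additive V -> W})
    (S : set V) (H : zmodClosed W) :
  (forall x, S x -> h x \in H) -> forall x, x \in zspan S -> h x \in H.
Proof.
move=> SH x.
pose P : {pred V} := fun y => h y \in H.
have Pcl : zmod_closed P.
  split=> [|u v hu hv]; first by rewrite unfold_in /P raddf0 rpred0.
  by rewrite unfold_in /P raddfB; exact: rpredB.
pose PH := GRing.isZmodClosed.Build V P Pcl.
pose Q : zmodClosed V := HB.pack P PH.
by move=> /asboolP /(_ Q); apply => y Sy; exact: SH.
Qed.

Section Subquotient.
Variables (V : zmodType) (Z B : zmodClosed V).

Definition zsub := {x : V | x \in Z}.
HB.instance Definition _ := SubChoice.on zsub.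
HB.instance Definition _ := [SubChoice_isSubZmodule of zsub by <:].

Definition zsub_den : {pred zsub} := fun x => val x \in B.

Lemma zsub_den_closed : zmod_closed zsub_den.
Proof.
split=> [|x y Bx By]; first by rewrite unfold_in /zsub_den raddf0 rpred0.
by rewrite unfold_in /zsub_den raddfB; exact: rpredB.
Qed.

HB.instance Definition _ :=
  GRing.isZmodClosed.Build zsub zsub_den zsub_den_closed.

(* Z / (Z :&: B) *)
Definition subquot := Quotient.quot zsub_den.
HB.instance Definition _ := GRing.Zmodule.on subquot.

Definition subquot_pi (x : zsub) : subquot := (\pi_(Quotient.quot zsub_den) x)%qT.

Lemma subquot_pi_additive : zmod_morphism subquot_pi.
Proof. by move=> x y; rewrite /subquot_pi raddfB. Qed.

HB.instance Definition _ :=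
  GRing.isZmodMorphism.Build zsub subquot subquot_pi subquot_pi_additive.

Lemma subquot_piE (x y : zsub) :
  (subquot_pi x == subquot_pi y) = (val x - val y \in B).
Proof.
by rewrite /subquot_pi -(Quotient.idealrBE (zsub_den : zmodClosed _)) unfold_in
           /zsub_den raddfB.
Qed.

End Subquotient.

Section SubquotientMap.
Variables (V W : zmodType) (Z B : zmodClosed V) (Z' B' : zmodClosed W).
Variables (h : {additive V -> W}).
Hypothesis hZ : forall x, x \in Z -> h x \in Z'.
Hypothesis hB : forall x, x \in Z -> x \in B -> h x \in B'.

Definition zsub_map (x : zsub Z) : zsub Z' := exist _ (h (val x)) (hZ (valP x)).

Definition subquot_fun (x : subquot Z B) : subquot Z' B' :=
  subquot_pi B' (zsub_map (repr x)).

Lemma subquot_funE (x : zsub Z) :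
  subquot_fun (subquot_pi B x) = subquot_pi B' (zsub_map x).
Proof.
apply/eqP; rewrite subquot_piE -[val _]/(h _) -[val (zsub_map x)]/(h _) -raddfB.
apply: hB.
  by rewrite -raddfB; exact: valP.
by rewrite -subquot_piE /subquot_pi reprK.
Qed.

Lemma subquot_fun_additive : zmod_morphism subquot_fun.
Proof.
move=> x y; rewrite -[x]reprK -[y]reprK.
rewrite -![(\pi _)%qT]/(subquot_pi B _) -raddfB !subquot_funE -raddfB.
by congr subquot_pi; apply: val_inj; rewrite /= !raddfB.
Qed.

Definition subquot_map : {additive subquot Z B -> subquot Z' B'} :=
  HB.pack subquot_fun
    (GRing.isZmodMorphism.Build _ _ subquot_fun subquot_fun_additive).

Lemma subquot_mapE (x : zsub Z) :
  subquot_map (subquot_pi B x) = subquot_pi B' (zsub_map x).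
Proof. exact: subquot_funE. Qed.

End SubquotientMap.

(* A diagram indexed by J with, for each pair of indices, a possibly non-unique
   family of arrows; for covers these are all the refinement projections. *)
Section Limits.
Variables (J : eqType) (arr : J -> J -> Type) (M : J -> zmodType).

Definition dprod := forall j, M j.
HB.instance Definition _ := gen_eqMixin dprod.
HB.instance Definition _ := gen_choiceMixin dprod.

Let dprod0 : dprod := fun=> 0.
Let dprod_opp (x : dprod) : dprod := fun j => - x j.
Let dprod_add (x y : dprod) : dprod := fun j => x j + y j.

Let dprod_addA : associative dprod_add.
Proof. by move=> x y z; apply: functional_extensionality_dep => j; exact: addrA. Qed.
Let dprod_addC : commutative dprod_add.
Proof. by move=> x y; apply: functional_extensionality_dep => j; exact: addrC. Qed.
Let dprod_add0 : left_id dprod0 dprod_add.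
Proof. by move=> x; apply: functional_extensionality_dep => j; exact: add0r. Qed.
Let dprod_addN : left_inverse dprod0 dprod_opp dprod_add.
Proof. by move=> x; apply: functional_extensionality_dep => j; exact: addNr. Qed.

HB.instance Definition _ :=
  GRing.isZmodule.Build dprod dprod_addA dprod_addC dprod_add0 dprod_addN.

Lemma dprodBE (x y : dprod) j : (x - y) j = x j - y j.
Proof. by []. Qed.

Section Inverse.
Variable f : forall i j, arr i j -> {additive M j -> M i}.

Definition compatible : {pred dprod} := fun x =>
  `[< forall i j (a : arr i j), f a (x j) = x i >].

Lemma compatible_closed : zmod_closed compatible.
Proof.
split=> [|x y /asboolP cx /asboolP cy]; apply/asboolP => i j a.
  by rewrite raddf0.
by rewrite !dprodBE raddfB cx cy.
Qed.

HB.instance Definition _ :=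
  GRing.isZmodClosed.Build dprod compatible compatible_closed.

Definition invlim := {x : dprod | x \in compatible}.
HB.instance Definition _ := SubChoice.on invlim.
HB.instance Definition _ := [SubChoice_isSubZmodule of invlim by <:].

End Inverse.

Section Direct.
Variable f : forall i j, arr i j -> {additive M i -> M j}.

Definition finsupp_fam : {pred dprod} := fun x =>
  `[< finite_set [set j | x j != 0] >].

Lemma finsupp_fam_closed : zmod_closed finsupp_fam.
Proof.
split=> [|x y /asboolP fx /asboolP fy]; apply/asboolP.
  by rewrite (_ : [set _ | _] = set0) // -subset0 => j /=; rewrite eqxx.
have fxy : finite_set ([set j | x j != 0] `|` [set j | y j != 0]) by rewrite finite_setU.
apply: sub_finite_set fxy => j /=.
rewrite dprodBE; have [->|] := eqVneq (x j) 0; last by left.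
by rewrite sub0r oppr_eq0; right.
Qed.

HB.instance Definition _ :=
  GRing.isZmodClosed.Build dprod finsupp_fam finsupp_fam_closed.

Definition dinj (i : J) (x : M i) : dprod := @eqtype.dfwith J M (fun=> 0) i x.

Definition dirlim_rel : set dprod := fun y =>
  exists i j (a : arr i j) (x : M i), y = dinj x - dinj (f a x).

(* The direct sum of the M j modulo the identifications x = f a x. *)
Definition dirlim : zmodType := subquot finsupp_fam (zspan dirlim_rel).

End Direct.

End Limits.

Section Complex.
Variable V : choiceType.

Record scomplex := SComplex {
  simplices :> {fset V} -> Prop;
  simplices_neq0 : forall s, simplices s -> s != fset0;
  simplices_sub : forall s t, simplices s -> (t `<=` s)%fset -> t != fset0 ->
    simplices t
}.

(* s lists, possibly with repetitions, the vertices of a simplex of K; it is an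
   ordered n-simplex, so that there is none when n < 0. *)
Definition osimplex (K : scomplex) (n : int) (s : seq V) : Prop :=
  (size s)%:Z = n + 1 /\ K [fset x in s]%fset.

Definition facet (i : nat) (s : seq V) : seq V := take i s ++ drop i.+1 s.

Lemma size_facet i s : (i < size s)%N -> size (facet i s) = (size s).-1.
Proof.
by move=> lis; rewrite size_cat size_drop size_takel ?(ltnW lis)//; case: (size s) lis => //= m lis; rewrite subSS subnKC.
Qed.

Lemma mem_facet i s : {subset facet i s <= s}.
Proof. by move=> x; rewrite mem_cat => /orP[/mem_take|/mem_drop]. Qed.

End Complex.

Section LinearExtension.
Variables (V : choiceType) (G W : zmodType) (h : V -> G -> W).

Definition malg_ext (c : malg V G) : W :=
  \sum_(s <- msupp c) h s (mcoeff s c).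

Hypothesis hD : forall s, zmod_morphism (h s).

Lemma malg_ext_additive : zmod_morphism malg_ext.
Proof.
have h0 s : h s 0 = 0 by rewrite -[X in h s X](subrr 0) hD subrr.
have ext (d : {fset V}) c : (msupp c `<=` d)%fset ->
    malg_ext c = \sum_(s <- d) h s (mcoeff s c).
  move=> cd; rewrite /malg_ext; apply: big_fset_incl => // s _ sc.
  by rewrite mcoeff_outdom.
move=> c d; pose e := (msupp c `|` msupp d)%fset.
rewrite (ext e (c - d)); last exact: msuppB_le.
rewrite (ext e c) ?fsubsetUl// (ext e d) ?fsubsetUr//.
by rewrite -sumrB; apply: eq_bigr => s _; rewrite mcoeffB hD.
Qed.

Lemma malg_extU s g : malg_ext (mkmalgU s g) = h s g.
Proof.
have h0 : h s 0 = 0 by rewrite -[X in h s X](subrr 0) hD subrr.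
rewrite /malg_ext msuppU; case: eqP => [->|_]; first by rewrite big_seq_fset0 h0.
by rewrite big_seq_fset1 mcoeffUU.
Qed.

End LinearExtension.

Lemma malg_additive_eq (V : choiceType) (G W : zmodType)
    (f h : {additive malg V G -> W}) :
  (forall s g, f (mkmalgU s g) = h (mkmalgU s g)) -> f =1 h.
Proof.
by move=> fh c; rewrite [c]monalgE !raddf_sum; apply: eq_bigr => s _; exact: fh.
Qed.

Section Homology.
Variables (V : choiceType) (G : zmodType) (n : int).

(* The degree 0 case is not augmented: the boundary of a vertex is 0. *)
Definition bdry1 (s : seq V) (g : G) : malg (seq V) G :=
  if (1 < size s)%N then
    \sum_(i < size s) mkmalgU (facet i s) (g *~ (-1) ^+ i)
  else 0.

Lemma bdry1_additive s : zmod_morphism (bdry1 s).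
Proof.
move=> g g'; rewrite /bdry1; case: ifP => _; last by rewrite subr0.
by rewrite -sumrB; apply: eq_bigr => i _; rewrite mulrzBl monalgUB.
Qed.

Definition bdry (c : malg (seq V) G) : malg (seq V) G := malg_ext bdry1 c.

HB.instance Definition _ :=
  GRing.isZmodMorphism.Build _ _ bdry (malg_ext_additive bdry1_additive).

Definition ochains (K : scomplex V) (m : int) : {pred malg (seq V) G} := fun c =>
  `[< forall s, s \in msupp c -> osimplex K m s >].

Lemma ochains_closed K m : zmod_closed (ochains K m).
Proof.
split=> [|c d /asboolP cK /asboolP dK]; apply/asboolP => s; first by rewrite msupp0.
by move/(fsubsetP (msuppB_le _ _)); rewrite in_fsetU => /orP[/cK|/dK].
Qed.

HB.instance Definition _ K m :=
  GRing.isZmodClosed.Build _ (ochains K m) (ochains_closed K m).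

(* Killing these generators turns ordered chains into oriented chains: a list
   with a repeated vertex is 0 and a transposition of two neighbours changes
   the sign. *)
Definition orient_rel (K : scomplex V) (m : int) : set (malg (seq V) G) := fun c =>
  (exists s g, [/\ osimplex K m s, ~~ uniq s & c = mkmalgU s g]) \/
  (exists s1 x y s2 g, osimplex K m (s1 ++ [:: x, y & s2]) /\
     c = mkmalgU (s1 ++ [:: x, y & s2]) g + mkmalgU (s1 ++ [:: y, x & s2]) g).

Section Pair.
Variables (K L : scomplex V).

(* The oriented relative chain group C_m(K, L; G) is ochains K m modulo this. *)
Definition null_chains (m : int) : {pred malg (seq V) G} :=
  zspan (fun c => c \in ochains L m \/ orient_rel K m c).
HB.instance Definition _ m := GRing.ZmodClosed.on (null_chains m).

Definition cycles : {pred malg (seq V) G} := fun c =>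
  (c \in ochains K n) && (bdry c \in null_chains (n - 1)).

Lemma cycles_closed : zmod_closed cycles.
Proof.
split=> [|c d /andP[cK cL] /andP[dK dL]]; apply/andP; split.
- exact: rpred0.
- by rewrite raddf0 rpred0.
- exact: rpredB.
- by rewrite raddfB rpredB.
Qed.

HB.instance Definition _ := GRing.isZmodClosed.Build _ cycles cycles_closed.

Definition boundaries : {pred malg (seq V) G} := fun c =>
  `[< exists2 b, b \in ochains K (n + 1) & c - bdry b \in null_chains n >].

Lemma boundaries_closed : zmod_closed boundaries.
Proof.
split=> [|c d /asboolP[b bK bc] /asboolP[e eK ed]]; apply/asboolP.
  exists 0; first exact: rpred0.
  by rewrite raddf0 subr0 rpred0.
exists (b - e); first exact: rpredB.
have -> : c - d - bdry (b - e) = (c - bdry b) - (d - bdry e).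
  rewrite raddfB -!addrA; congr (_ + _); rewrite !opprB addrCA [RHS]addrCA.
  by congr (_ + _); rewrite addrC.
exact: rpredB.
Qed.

HB.instance Definition _ :=
  GRing.isZmodClosed.Build _ boundaries boundaries_closed.

Definition homology : zmodType := subquot cycles boundaries.

End Pair.
End Homology.

Section Cohomology.
Variables (V : choiceType) (G : zmodType) (n : int).

(* Oriented relative cochains: alternating functions on the ordered m-simplices
   of K, vanishing on those of L, extended by 0. *)
Definition cochains (K L : scomplex V) (m : int) : {pred seq V -> G} := fun f =>
  `[< [/\ forall s, f s != 0 -> osimplex K m s /\ ~ L [fset x in s]%fset,
          forall s, ~~ uniq s -> f s = 0 &
          forall s1 x y s2, f (s1 ++ [:: x, y & s2]) = - f (s1 ++ [:: y, x & s2])]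
   >].

Lemma cochains_closed K L m : zmod_closed (cochains K L m).
Proof.
split=> [|f g /asboolP[f1 f2 f3] /asboolP[g1 g2 g3]]; apply/asboolP.
  split=> [s|s _|s1 x y s2]; rewrite ?oppr0//.
  by move=> /negP; rewrite eqxx.
split=> [s|s us|s1 x y s2].
- rewrite -[(f - g) s]/(f s - g s); have [fs0|fs0 _] := eqVneq (f s) 0.
    by rewrite fs0 sub0r oppr_eq0 => /g1.
  exact: f1.
- by rewrite -[(f - g) s]/(f s - g s) f2// g2// subr0.
- by rewrite -![(f - g) _]/(f _ - g _) f3 g3 opprB opprK addrC.
Qed.

HB.instance Definition _ K L m :=
  GRing.isZmodClosed.Build _ (cochains K L m) (cochains_closed K L m).

Definition cobdry (K : scomplex V) (f : seq V -> G) : seq V -> G := fun s =>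
  if `[< K [fset x in s]%fset >] then
    \sum_(i < size s) f (facet i s) *~ (-1) ^+ i
  else 0.

Lemma cobdry_additive K : zmod_morphism (cobdry K).
Proof.
move=> f g; apply/funext => s.
rewrite -[RHS]/(cobdry K f s - cobdry K g s) /cobdry; case: ifP => _.
  by rewrite -sumrB; apply: eq_bigr => i _; rewrite -mulrzBl.
by rewrite subr0.
Qed.

HB.instance Definition _ K :=
  GRing.isZmodMorphism.Build _ _ (cobdry K) (@cobdry_additive K).

Section Pair.
Variables (K L : scomplex V).

Definition cocycles : {pred seq V -> G} := fun f =>
  (f \in cochains K L n) && (cobdry K f == 0).

Lemma cocycles_closed : zmod_closed cocycles.
Proof.
split=> [|f g /andP[fK /eqP f0] /andP[gK /eqP g0]]; apply/andP; split.
- exact: rpred0.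
- by rewrite (raddf0 (cobdry K)).
- exact: rpredB.
- by rewrite cobdry_additive f0 g0 subr0.
Qed.

HB.instance Definition _ := GRing.isZmodClosed.Build _ cocycles cocycles_closed.

Definition coboundaries : {pred seq V -> G} := fun f =>
  `[< exists2 g, g \in cochains K L (n - 1) & f = cobdry K g >].

Lemma coboundaries_closed : zmod_closed coboundaries.
Proof.
split=> [|f g /asboolP[b bK ->] /asboolP[e eK ->]]; apply/asboolP.
  by exists 0; [exact: rpred0|rewrite (raddf0 (cobdry K))].
by exists (b - e); [exact: rpredB|rewrite cobdry_additive].
Qed.

HB.instance Definition _ :=
  GRing.isZmodClosed.Build _ coboundaries coboundaries_closed.

Definition cohomology : zmodType := subquot cocycles coboundaries.

End Pair.
End Cohomology.

Lemma map_facet (V W : choiceType) (p : V -> W) i s :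
  map p (facet i s) = facet i (map p s).
Proof. by rewrite /facet map_cat map_take map_drop. Qed.

Section InducedMaps.
Variables (W V : choiceType) (G : zmodType) (n : int) (p : W -> V).
Variables (K' L' : scomplex W) (K L : scomplex V).
Hypothesis pK : forall s, K' s -> K [fset p v | v in s]%fset.
Hypothesis pL : forall s, L' s -> L [fset p v | v in s]%fset.

Let fset_map (s : seq W) :
  [fset x in map p s]%fset = [fset p v | v in [fset x in s]]%fset.
Proof.
apply/fsetP => x; rewrite !inE; apply/mapP/imfsetP => -[y ys ->];
  by exists y => //; rewrite inE in ys *.
Qed.

Let osimplex_map (A : scomplex W) (B : scomplex V) m s :
  (forall s, A s -> B [fset p v | v in s]%fset) ->
  osimplex A m s -> osimplex B m (map p s).
Proof. by move=> AB [sz sA]; split; rewrite ?size_map// fset_map; exact: AB. Qed.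

Definition push (c : malg (seq W) G) : malg (seq V) G :=
  malg_ext (fun s g => mkmalgU (map p s) g) c.

Let push1_additive s : zmod_morphism (fun g : G => mkmalgU (map p s) g).
Proof. by move=> g g'; exact: monalgUB. Qed.

HB.instance Definition _ :=
  GRing.isZmodMorphism.Build _ _ push (malg_ext_additive push1_additive).

Lemma pushU s g : push (mkmalgU s g) = mkmalgU (map p s) g.
Proof. exact: (malg_extU push1_additive). Qed.

Lemma pushD c d : push (c + d) = push c + push d.
Proof. exact: raddfD. Qed.

Lemma push_bdry c : push (bdry c) = bdry (push c).
Proof.
move: c.
apply: (malg_additive_eq (f := push \o bdry (G:=G)) (h := bdry (G:=G) \o push)).
move=> s g.
rewrite /= pushU /bdry !(malg_extU (@bdry1_additive _ _)) /bdry1 size_map.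
case: ifP => _; last by rewrite raddf0.
rewrite (raddf_sum push); apply: eq_bigr => i _.
by rewrite -[LHS]/(push _) pushU map_facet.
Qed.

Lemma push_ochains (A : scomplex W) (B : scomplex V) m :
  (forall s, A s -> B [fset p v | v in s]%fset) ->
  forall c, c \in ochains A m -> push c \in ochains B m.
Proof.
move=> AB c /asboolP cA; rewrite /push /malg_ext big_seq; apply: rpred_sum.
move=> s /cA sA; apply/asboolP => t /(fsubsetP msuppU_le).
by rewrite in_fset1 => /eqP ->; exact: osimplex_map sA.
Qed.

Lemma push_null m c :
  c \in null_chains K' L' m -> push c \in null_chains K L m.
Proof.
move: c; apply: (zspan_map (H := null_chains K L m)) => c.
rewrite -[X in _ -> X \in _]/(push c); case=> [cL|[[s [g [sK us ->]]]|[s1 [x [y [s2 [g [sK ->]]]]]]]].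
- by apply: mem_zspan; left; exact: push_ochains cL.
- apply: mem_zspan; right; left; exists (map p s), g; rewrite pushU; split=> //.
    exact: osimplex_map sK.
  by apply: contra us => /map_uniq.
- apply: mem_zspan; right; right.
  exists (map p s1), (p x), (p y), (map p s2), g.
  rewrite pushD !pushU !map_cat; split=> //.
  by have := osimplex_map pK sK; rewrite map_cat.
Qed.

Lemma push_cycles c : c \in cycles n K' L' -> push c \in cycles n K L.
Proof.
move=> /andP[cK cL]; apply/andP; split; first exact: push_ochains cK.
by rewrite -push_bdry; exact: push_null.
Qed.

Lemma push_boundaries c : c \in cycles n K' L' ->
  c \in boundaries n K' L' -> push c \in boundaries n K L.
Proof.
move=> _ /asboolP[b bK cb]; apply/asboolP; exists (push b).
  exact: push_ochains bK.
by rewrite -push_bdry -raddfB; exact: push_null.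
Qed.

Definition homology_map : {additive homology G n K' L' -> homology G n K L} :=
  subquot_map push_cycles push_boundaries.

Definition pull (f : seq V -> G) : seq W -> G := fun s =>
  if `[< K' [fset x in s]%fset >] then f (map p s) else 0.

Lemma pull_additive : zmod_morphism pull.
Proof.
move=> f g; apply/funext => s; rewrite -[RHS]/(pull f s - pull g s) /pull.
by case: ifP => _; rewrite ?subr0.
Qed.

HB.instance Definition _ := GRing.isZmodMorphism.Build _ _ pull pull_additive.

Lemma pull_cochains m f : f \in cochains K L m -> pull f \in cochains K' L' m.
Proof.
move=> /asboolP[f1 f2 f3]; apply/asboolP; split=> [s|s us|s1 x y s2].
- rewrite /pull; case: asboolP => [sK fs|_]; last by rewrite eqxx.
  have [[sz _] sL] := f1 _ fs; split; first by split=> //; rewrite -sz size_map.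
  by move=> /pL; rewrite -fset_map.
- rewrite /pull; case: ifP => // _; apply: f2.
  by apply: contra us => /map_uniq.
- have xy : [fset z in s1 ++ [:: y, x & s2]]%fset =
            [fset z in s1 ++ [:: x, y & s2]]%fset.
    by apply/fsetP => z; rewrite !inE; congr (_ || _); exact: orbCA.
  by rewrite /pull xy; case: ifP => _; rewrite ?oppr0// !map_cat f3.
Qed.

Lemma pull_cobdry m f : f \in cochains K L m ->
  pull (cobdry K f) = cobdry K' (pull f).
Proof.
move=> /asboolP[f1 _ _]; apply/funext => s; rewrite /pull /cobdry.
case: asboolP => // sK; rewrite asboolT; last by rewrite fset_map; exact: pK.
rewrite size_map; apply: eq_bigr => i _; rewrite -map_facet.
case: asboolP => // nK; have [->//|/f1[[_ mK] _]] := eqVneq (f (map p (facet i s))) 0.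
exfalso; apply: nK; apply: (simplices_sub sK).
  by apply/fsubsetP => x; rewrite !inE => /orP[/mem_take|/mem_drop].
apply: contraNneq (simplices_neq0 mK) => e0.
by rewrite fset_map e0 imfset0 eqxx.
Qed.

Lemma pull_cocycles f : f \in cocycles n K L -> pull f \in cocycles n K' L'.
Proof.
move=> /andP[fK /eqP f0]; apply/andP; split; first exact: pull_cochains.
by rewrite -(pull_cobdry fK) f0 (raddf0 pull).
Qed.

Lemma pull_coboundaries f : f \in cocycles n K L ->
  f \in coboundaries n K L -> pull f \in coboundaries n K' L'.
Proof.
move=> _ /asboolP[g gK ->]; apply/asboolP; exists (pull g).
  exact: pull_cochains.
by rewrite (pull_cobdry gK).
Qed.

Definition cohomology_map :
    {additive cohomology G n K L -> cohomology G n K' L'} :=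
  subquot_map pull_cocycles pull_coboundaries.

End InducedMaps.

Section Nerve.
Variables (X : Type) (V : choiceType) (U : V -> set X) (A : set X).

Definition nerve_simplices (s : {fset V}) : Prop :=
  s != fset0 /\ A `&` \bigcap_(v in [set` s]) U v !=set0.

Lemma nerve_neq0 s : nerve_simplices s -> s != fset0.
Proof. by case. Qed.

Lemma nerve_sub s t : nerve_simplices s -> (t `<=` s)%fset -> t != fset0 ->
  nerve_simplices t.
Proof.
move=> [_ [x [Ax sx]]] /fsubsetP ts t0; split=> //.
by exists x; split=> // v /ts vs; exact: sx.
Qed.

Definition nerve : scomplex V := SComplex nerve_neq0 nerve_sub.

End Nerve.

(* Limits of the groups of the nerves over a class J of covers of X, the cover of
   index j being the family U j : V j -> set X. There is a projection i j exactly
   when i <= j; as all projections from j to i induce the same homomorphism,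
   imposing the bonding relations for each of them adds nothing. *)
Section Cech.
Variables (X : Type) (A : set X).
Variables (J : eqType) (V : J -> choiceType) (U : forall j, V j -> set X).
Arguments U : clear implicits.
Variables (G : zmodType) (n : int).

Definition projection (i j : J) :=
  {p : V j -> V i | forall v, U j v `<=` U i (p v)}.

Lemma projection_nerve i j (p : projection i j) (B : set X) s :
  nerve (U j) B s -> nerve (U i) B [fset sval p v | v in s]%fset.
Proof.
case: p => p pU [] /= s0 [x [Bx sx]]; split.
  have [v vs] := fset0Pn _ s0; apply/fset0Pn; exists (p v).
  by apply/imfsetP; exists v.
exists x; split=> // _ /imfsetP[v vs ->]; apply: pU; exact: sx.
Qed.

Definition nerve_homology : zmodType :=
  invlim (fun i j (p : projection i j) =>
    homology_map G n (projection_nerve p (B := setT))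
                     (projection_nerve p (B := A))).

Definition nerve_cohomology : zmodType :=
  dirlim (fun i j (p : projection i j) =>
    cohomology_map G n (projection_nerve p (B := setT))
                       (projection_nerve p (B := A))).

End Cech.

Section FunctionalGroups.
Variables (R : realType) (X : topologicalType).

Definition functionally_open (U : set X) : Prop :=
  exists f : X -> R, [/\ continuous f, range f `<=` `[0, 1] & U = f @^-1` `]0, 1]].

Record fo_cover := FOCover {
  fo_size : nat;
  fo_set : 'I_fo_size -> set X;
  fo_setP : forall v, functionally_open (fo_set v);
  fo_setT : \bigcup_v fo_set v = setT
}.
HB.instance Definition _ := gen_eqMixin fo_cover.

Definition functional_homology (A : set X) (G : zmodType) (n : int) : zmodType :=
  nerve_homology A fo_set G n.

Definition functional_cohomology (A : set X) (G : zmodType) (n : int) : zmodType :=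
  nerve_cohomology A fo_set G n.

(* A map A -> [0, 1] is represented by any, possibly discontinuous, f : X -> R
   that restricts to it. *)
Definition completely_closed (A : set X) : Prop :=
  closed A /\
  forall f : X -> R, {within A, continuous f} -> f @` A `<=` `[0, 1] ->
    exists g : X -> R, [/\ continuous g, range g `<=` `[0, 1] & {in A, g =1 f}].

End FunctionalGroups.

Section CechGroups.
Variable X : topologicalType.

(* An arbitrary open cover is a set of open sets, indexed by itself. *)
Record open_cover := OpenCover {
  oc_family : set (set X);
  oc_open : forall U, oc_family U -> open U;
  oc_setT : \bigcup_(U in oc_family) U = setT
}.
HB.instance Definition _ := gen_eqMixin open_cover.

Definition oc_set (D : open_cover) : set_type (oc_family D) -> set X := set_val.

Definition cech_homology (A : set X) (G : zmodType) (n : int) : zmodType :=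
  nerve_homology A oc_set G n.

Definition cech_cohomology (A : set X) (G : zmodType) (n : int) : zmodType :=
  nerve_cohomology A oc_set G n.

End CechGroups.

Definition tychonoff_space (X : topologicalType) : Prop :=
  hausdorff_space X /\ completely_regular_space X.

Definition topological_embedding (X Y : topologicalType) (i : X -> Y) : Prop :=
  injective i /\
  forall U : set X, open U <-> exists2 W : set Y, open W & i @^-1` W = U.

Definition stone_cech (X bX : topologicalType) (i : X -> bX) : Prop :=
  [/\ compact [set: bX], hausdorff_space bX, topological_embedding i,
      closure (range i) = setT &
      forall (K : topologicalType) (f : X -> K),
        compact [set: K] -> hausdorff_space K -> continuous f ->
        exists2 g : bX -> K, continuous g & forall x, g (i x) = f x].

Definition zmod_isomorphic (M N : zmodType) : Prop :=
  exists f : {additive M -> N}, bijective f.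

(* Main.v *)
(* A nonempty intersection O of finitely many open sets of bX meets closure (i @` A)
   exactly when A meets i @^-1` O. Hence the nerves of an open cover of bX, with
   the subcomplex given by closure (i @` A), are the nerves over (X, A) of its
   restriction to X, and only covers of X need to be compared.

   The two kinds of covers of X refine each other. Given an open cover of bX,
   compactness and complete regularity of bX give a finite functionally open
   refinement, which restricts to X. Given a functionally open cover
   {f_k > 0} of X, the normalised functions f_k / sum f extend to bX, still with
   sum 1, so the sets where the extensions are positive cover bX and restrict to
   the given cover.

   Any two refinement projections are contiguous, hence induce the same
   homomorphism, and the limits over two mutually cofinal systems agree. Since
   the prism operator of a contiguity does not respect oriented chains, two
   contiguous maps are joined by changing one vertex at a time: if p and q differ
   at v only, s1 v s2 |-> (-1)^|s1| p(s1) p(v) q(v) p(s2) does respect orientation.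
   This needs finitely many vertices, which finite subcovers provide. *)
Require Import Defs.
From HB Require Import structures.
From mathcomp Require Import all_boot all_order all_algebra.
From mathcomp Require Import all_classical all_reals all_analysis.
From mathcomp Require Import finmap.
From mathcomp Require Import -(notations) monalg.

Set Implicit Arguments.
Unset Strict Implicit.
Unset Printing Implicit Defensive.

Import Order.TTheory GRing.Theory Num.Theory.
Import numFieldNormedType.Exports.

Local Open Scope classical_set_scope.
Local Open Scope ring_scope.

(** * Alternating functions on lists of vertices *)

Section Alternating.
Variables (V : choiceType) (M : zmodType).
Implicit Types (f g : seq V -> M) (s t u : seq V).

(** Values lie in an arbitrary abelian group, so that one calculation serves cochains (values in
    [G]) and oriented chains (values in a quotient of the ordered chains). Only adjacent repetitions
    are mentioned; a general repetition reduces to them by moving a vertex to the front. *)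
Definition altfun f :=
  (forall s1 x s2, f (s1 ++ [:: x, x & s2]) = 0) /\
  (forall s1 x y s2, f (s1 ++ [:: x, y & s2]) = - f (s1 ++ [:: y, x & s2])).

Lemma altfun_cons f x : altfun f -> altfun (fun u => f (x :: u)).
Proof. by case=> f0 fN; split=> s1 *; [exact: (f0 (x :: s1))|exact: (fN (x :: s1))]. Qed.

Lemma altfunB f g : altfun f -> altfun g ->
  altfun (fun u => f u - g u).
Proof.
move=> [f0 fN] [g0 gN]; split=> [s1 x s2|s1 x y s2]; first by rewrite f0 g0 subr0.
by rewrite fN gN opprB addrC opprK.
Qed.

Lemma altfun_move f s1 v s2 : altfun f ->
  f (s1 ++ v :: s2) = f (v :: s1 ++ s2) *~ (-1) ^+ size s1.
Proof.
elim: s1 f => [|x s1 IH] f af /=; first by rewrite expr0 mulr1z.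
rewrite (IH (fun u => f (x :: u))); last exact: altfun_cons.
by rewrite (af.2 [::]) /= exprS mulN1r mulrNz mulNrz.
Qed.

Lemma altfun_uniq f s : altfun f -> ~~ uniq s -> f s = 0.
Proof.
elim: s f => //= x s IH f af; rewrite negb_and negbK => /orP[/splitPr[s1 s2]|us].
  rewrite (altfun_move s1 x s2 (altfun_cons x af)) (af.1 [::]).
  by rewrite mul0rz.
by rewrite (IH (fun u => f (x :: u)))//; exact: altfun_cons.
Qed.

Lemma altfunP f :
  (forall s, ~~ uniq s -> f s = 0) ->
  (forall s1 x y s2, f (s1 ++ [:: x, y & s2]) = - f (s1 ++ [:: y, x & s2])) ->
  altfun f.
Proof.
by move=> f0 fN; split=> // s1 x s2; rewrite f0// cat_uniq /= inE eqxx/= !andbF.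
Qed.

(** A repeated vertex kills [f], and a single occurrence of [v] can be moved to the front at the
    cost of a sign. An identity between alternating functions thus only needs checking where [v]
    comes first or is absent. *)
Lemma altfun_eq0 f v : altfun f ->
  (forall s, uniq (v :: s) -> f (v :: s) = 0) ->
  (forall s, v \notin s -> f s = 0) -> forall s, f s = 0.
Proof.
move=> af fv f0 s; have [us|] := boolP (uniq s); last exact: altfun_uniq.
have [vs|] := boolP (v \in s); last exact: f0.
case/splitPr: vs us => s1 s2; rewrite -cat1s uniq_catCA => us.
by rewrite cat1s altfun_move// fv ?mul0rz.
Qed.

(** The alternating sum over facets, in a recursive form that allows induction on the list with [f]
    replaced by [fun u => f (x :: u)]. It is augmented: on a single vertex it gives [f [::]],
    whereas [bdry] gives 0 there. *)
Fixpoint codiff f s : M :=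
  if s is x :: t then f t - codiff (fun u => f (x :: u)) t else 0.

Lemma codiffE f s :
  codiff f s = \sum_(i < size s) f (facet i s) *~ (-1) ^+ i.
Proof.
elim: s f => [|x s IH] f /=; first by rewrite big_ord0.
rewrite big_ord_recl expr0 mulr1z /facet /= drop0; congr (_ + _).
rewrite IH -sumrN; apply: eq_bigr => i _.
by rewrite /= /bump /= add1n exprS mulN1r mulrNz.
Qed.

Lemma eq_codiff f g s :
  (forall u, (size u).+1 = size s -> {subset u <= s} -> f u = g u) ->
  codiff f s = codiff g s.
Proof.
move=> fg; rewrite !codiffE; apply: eq_bigr => i _; rewrite fg//.
  by rewrite size_facet//; case: (s) i => [[]|].
exact: mem_facet.
Qed.

Lemma codiff0 s : codiff (fun=> 0) s = 0.
Proof. by rewrite codiffE big1// => i _; rewrite mul0rz. Qed.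

Lemma codiffN f s : codiff (fun u => - f u) s = - codiff f s.
Proof. by rewrite !codiffE -sumrN; apply: eq_bigr => i _; rewrite mulNrz. Qed.

Lemma altfun_codiff f : altfun f -> altfun (codiff f).
Proof.
move=> af; split=> [s1 x s2|s1 x y s2]; elim: s1 f af => [|z s1 IH] f af /=.
- rewrite subKr (@eq_codiff _ (fun=> 0)) ?codiff0// => u _ _.
  exact: (af.1 [::]).
- by rewrite af.1 IH ?subr0//; exact: altfun_cons.
- rewrite (@eq_codiff (fun u => f [:: x, y & u]) (fun u => - f [:: y, x & u])).
    by rewrite codiffN opprK opprB opprD addrA addrAC.
  by move=> u _ _; exact: (af.2 [::]).
- by rewrite af.2 IH ?opprB ?opprK; [rewrite addrC|exact: altfun_cons].
Qed.

End Alternating.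

Lemma codiff_map (W V : choiceType) (M : zmodType) (p : W -> V) (f : seq V -> M) s :
  codiff (fun u => f (map p u)) s = codiff f (map p s).
Proof. by elim: s f => //= x s IH f; rewrite (IH (fun u => f (p x :: u))). Qed.

(** * The prism operator for two maps that differ at one vertex *)

Section Prism.
Variables (W V : choiceType) (M : zmodType) (v : W) (p : W -> V).
Implicit Types (h f : seq V -> M) (s t : seq W) (u : seq V).

(* On a list containing v this is (-1) ^ (index v s) times the value of h at the
   image under p of s with its first v removed. *)
Fixpoint extract h s : M :=
  if s is x :: t then
    if x == v then h (map p t) else - extract (fun u => h (p x :: u)) t
  else 0.

Lemma eq_extract h h' s :
  (forall u, (size u).+1 = size s -> v \in s -> {subset u <= map p s} ->
     h u = h' u) ->
  extract h s = extract h' s.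
Proof.
elim: s h h' => //= x s IH h h' hh'; case: eqVneq => [xv|xv].
  rewrite hh' ?size_map ?xv ?mem_head// => y ys.
  by rewrite inE ys orbT.
congr (- _); apply: IH => u us vs su; apply: hh'; rewrite /= ?us//.
  by rewrite inE vs orbT.
by move=> y; rewrite !inE => /orP[->//|/su ->]; rewrite orbT.
Qed.

Lemma extract0 s : extract (fun=> 0) s = 0.
Proof. by elim: s => //= x s ->; rewrite oppr0 if_same. Qed.

Lemma extractN h s : extract (fun u => - h u) s = - extract h s.
Proof.
by elim: s h => [|x s IH] h /=; [rewrite oppr0|case: ifP => // _; rewrite IH].
Qed.

Lemma extractB h h' s :
  extract (fun u => h u - h' u) s = extract h s - extract h' s.
Proof.
elim: s h h' => [|x s IH] h h' /=; first by rewrite subr0.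
by case: ifP => // _; rewrite IH opprB opprK addrC.
Qed.

Lemma extract_notin h s : v \notin s -> extract h s = 0.
Proof.
by move=> vs; rewrite (@eq_extract _ (fun=> 0)) ?extract0// => u _; rewrite (negPf vs).
Qed.

(** Swapping [v] with a neighbour shifts its index by one, which gives the sign. If [v] occurs
    twice, removing the first occurrence leaves [p v] in the list, and the second hypothesis makes
    [h] vanish. *)
Lemma altfun_extract h : altfun h -> (forall u, p v \in u -> h u = 0) ->
  altfun (extract h).
Proof.
move=> ah h0; split=> [s1 x s2|s1 x y s2]; elim: s1 h ah h0 => [|z s1 IH] h ah h0 /=.
- case: eqVneq => [->|_]; first by rewrite h0// mem_head.
  rewrite opprK (@eq_extract _ (fun=> 0)) ?extract0// => u _ _ _.
  exact: (ah.1 [::]).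
- case: eqVneq => [_|_]; first by rewrite map_cat ah.1.
  rewrite IH ?oppr0//; first exact: altfun_cons.
  by move=> u pu; rewrite h0// inE pu orbT.
- case: (eqVneq x v) => [->|xv]; case: (eqVneq y v) => [yv|yv].
  + by rewrite yv h0 ?oppr0// mem_head.
  + by rewrite opprK.
  + by [].
  + rewrite !opprK -extractN; apply: eq_extract => u _ _ _.
    exact: (ah.2 [::]).
- case: eqVneq => [_|_]; first by rewrite !map_cat ah.2.
  rewrite IH//; first exact: altfun_cons.
  by move=> u pu; rewrite h0// inE pu orbT.
Qed.

Variable q : W -> V.

(** For alternating [f] this is [f] evaluated on the prism over [s]. Writing [p v], [q v] in front
    instead of at the place of [v] costs no sign, as two vertices are moved together past the images
    of the preceding ones. *)
Definition prism f s : M := extract (fun u => f [:: p v, q v & u]) s.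

Lemma altfun_prism f : altfun f -> altfun (prism f).
Proof.
move=> af; apply: altfun_extract.
  exact: (altfun_cons (q v) (altfun_cons (p v) af)).
by move=> u pu; rewrite (altfun_uniq af)//= inE pu orbT.
Qed.

Hypothesis pq : forall x, x != v -> q x = p x.

(** Both sides alternate in [s], so [altfun_eq0] leaves two cases. No complex enters here: the
    identity holds on all lists. *)
Lemma prism_homotopy f s : altfun f ->
  codiff (prism f) s + prism (codiff f) s = f (map q s) - f (map p s).
Proof.
move=> af; have amap (r : W -> V) : altfun (fun s => f (map r s)).
  by split=> [s1 x s2|s1 x y s2]; rewrite !map_cat; [exact: af.1|exact: af.2].
have qps t : v \notin t -> map q t = map p t.
  by move=> vt; apply/eq_in_map => x xt; apply/pq; apply: contraNneq vt => <-.
suff E : codiff (prism f) s - ((f (map q s) - f (map p s)) - prism (codiff f) s) = 0.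
  by move/eqP: E; rewrite subr_eq0 => /eqP ->; rewrite subrK.
move: s; apply: (@altfun_eq0 _ _ _ v) => [|s /= /andP[vs _]|s vs].
- apply: altfunB; first exact/altfun_codiff/altfun_prism.
  apply: altfunB; first exact: altfunB.
  exact/altfun_prism/altfun_codiff.
(* Deleting [p v] or [q v] from the prism over [v :: s] produces the right-hand side. The facets
   that keep both cancel against [codiff (prism f)]. *)
- have prism_cons g t : prism g (v :: t) = g [:: p v, q v & map p t].
    by rewrite /prism /= eqxx.
  rewrite prism_cons /= [prism f s]extract_notin// sub0r qps//.
  rewrite -(codiff_map p (fun u => f [:: p v, q v & u])).
  rewrite -(@eq_codiff _ _ (fun t => prism f (v :: t)))//.
  by rewrite [- (_ - codiff _ _)]opprB addrCA opprB addrK addNr.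
(* Without [v] in [s] the two images coincide and every prism term is 0. *)
- rewrite qps// subrr sub0r opprK {2}/prism extract_notin// addr0.
  rewrite (@eq_codiff _ _ _ (fun=> 0)) ?codiff0// => u _ us.
  by apply: extract_notin; apply: contra vs => /us.
Qed.

End Prism.

Lemma raddf_extract (W V : choiceType) (M N : zmodType) (phi : {additive M -> N})
    (v : W) (p : W -> V) h s :
  phi (extract v p h s) = extract v p (fun u => phi (h u)) s.
Proof.
elim: s h => [|x s IH] h /=; first by rewrite raddf0.
by case: ifP => // _; rewrite raddfN IH.
Qed.

(** * Contiguous simplicial maps *)

Lemma rpred_extract (W V : choiceType) (M : zmodType) (S : zmodClosed M) (v : W)
    (p : W -> V) h s :
  (forall u, (size u).+1 = size s -> v \in s -> {subset u <= map p s} ->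
     h u \in S) ->
  extract v p h s \in S.
Proof.
elim: s h => [|x s IH] h hS /=; first exact: rpred0.
case: eqVneq => [xv|xv].
  apply: hS; rewrite /= ?size_map ?xv ?mem_head// => y ys.
  by rewrite inE ys orbT.
rewrite rpredN; apply: IH => u us vs su; apply: hS; rewrite /= ?us//.
  by rewrite inE vs orbT.
by move=> y; rewrite !inE => /orP[->//|/su ->]; rewrite orbT.
Qed.

(** Asking for all nonempty lists with entries in the two images includes that both maps are
    simplicial, and applies at once to prisms and to their facets. *)
Definition contiguous (W V : choiceType) (K' : scomplex W) (K : scomplex V)
    (p q : W -> V) :=
  forall (s : seq W) (t : seq V), K' [fset x in s]%fset -> t != [::] ->
    {subset t <= map p s ++ map q s} -> K [fset x in t]%fset.

Lemma osimplex_contiguous (W V : choiceType) (K' : scomplex W) (K : scomplex V)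
    (p q : W -> V) (m m' : int) s t : contiguous K' K p q ->
  osimplex K' m s -> t != [::] -> {subset t <= map p s ++ map q s} ->
  (size t)%:Z = m' + 1 -> osimplex K m' t.
Proof. by move=> pq [_ sK] t0 ts szt; split=> //; exact: pq ts. Qed.

Lemma osimplex_swap (V : choiceType) (K : scomplex V) m s1 x y s2 :
  osimplex K m (s1 ++ [:: x, y & s2]) -> osimplex K m (s1 ++ [:: y, x & s2]).
Proof.
case=> sz sK; split; first by rewrite -sz !size_cat.
rewrite (_ : [fset z in _]%fset = [fset z in s1 ++ [:: x, y & s2]]%fset)//.
by apply/fsetP => z; rewrite !inE; congr (_ || _); exact: orbCA.
Qed.

Lemma raddf_codiff (V : choiceType) (M N : zmodType) (phi : {additive M -> N})
    (f : seq V -> M) s :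
  phi (codiff f s) = codiff (fun u => phi (f u)) s.
Proof. by rewrite !codiffE raddf_sum; apply: eq_bigr => i _; rewrite raddfMz. Qed.

(** * The prism operator on oriented relative chains *)

Section QuotientChains.
Variables (V : choiceType) (G : zmodType) (K L : scomplex V) (n : int).

(* Extended by 0 so that it alternates on all lists, simplices or not. *)
Definition ochain_class (g : G) (u : seq V) :
    Quotient.quot (null_chains (G := G) K L n) :=
  if `[< osimplex K n u >] then (\pi_(Quotient.quot _) (mkmalgU u g))%qT else 0.

Lemma ochain_classE g u : osimplex K n u ->
  ochain_class g u = (\pi_(Quotient.quot _) (mkmalgU u g))%qT.
Proof. by move=> uK; rewrite /ochain_class asboolT. Qed.

Lemma quot_pi_eq0 (M : zmodType) (I : zmodClosed M) (x : M) :
  (x \in I) = ((\pi_(Quotient.quot I) x)%qT == 0).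
Proof. by rewrite -[in LHS](subr0 x) Quotient.idealrBE raddf0. Qed.

(** The two kinds of generators of [orient_rel] become the two alternation laws in the quotient. *)
Lemma altfun_ochain_class g : altfun (ochain_class g).
Proof.
apply: altfunP => [s us|s1 x y s2]; rewrite /ochain_class.
  case: asboolP => // sK; apply/eqP; rewrite -quot_pi_eq0.
  by apply: mem_zspan; right; left; exists s, g.
case: asboolP => xyK; case: asboolP => yxK; rewrite ?oppr0//.
- apply/eqP; rewrite -addr_eq0 -raddfD -quot_pi_eq0.
  by apply: mem_zspan; right; right; exists s1, x, y, s2, g.
- by case: yxK; exact: osimplex_swap.
- by case: xyK; exact: osimplex_swap.
Qed.

End QuotientChains.

Lemma bdryU (V : choiceType) (G : zmodType) (s : seq V) (g : G) :
  (1 < size s)%N -> bdry (mkmalgU s g) = codiff (fun u => mkmalgU u g) s.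
Proof.
move=> s1; rewrite /bdry (malg_extU (@bdry1_additive _ _)) /bdry1 s1 codiffE.
by apply: eq_bigr => i _; rewrite raddfMz.
Qed.

Lemma mem_ochainsU (V : choiceType) (G : zmodType) (K : scomplex V) m s (g : G) :
  osimplex K m s -> mkmalgU s g \in ochains K m.
Proof.
by move=> sK; apply/asboolP => t /(fsubsetP msuppU_le); rewrite in_fset1 => /eqP ->.
Qed.

Lemma ochains_ind (V : choiceType) (G M : zmodType) (K : scomplex V) m
    (S : zmodClosed M) (F : {additive malg (seq V) G -> M}) :
  (forall s g, osimplex K m s -> F (mkmalgU s g) \in S) ->
  forall c, c \in ochains K m -> F c \in S.
Proof.
move=> FS c /asboolP cK; rewrite [c]monalgE raddf_sum big_seq.
by apply: rpred_sum => s /cK /FS.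
Qed.

Section PrismChain.
Variables (W V : choiceType) (G : zmodType) (v : W) (p q : W -> V).

(** The linear extension of [prism] at the tautological chain-valued function
    [fun u => mkmalgU u g]. *)
Definition prism_chain (c : malg (seq W) G) : malg (seq V) G :=
  malg_ext (fun s g => prism v p q (fun u => mkmalgU u g) s) c.

Let prism1_additive s :
  zmod_morphism (fun g : G => prism v p q (fun u => mkmalgU u g) s).
Proof.
move=> g g'; rewrite /prism -extractB; apply: eq_extract => u _ _ _.
exact: monalgUB.
Qed.

HB.instance Definition _ :=
  GRing.isZmodMorphism.Build _ _ prism_chain (malg_ext_additive prism1_additive).

Lemma prism_chainU s g :
  prism_chain (mkmalgU s g) = prism v p q (fun u => mkmalgU u g) s.
Proof. exact: (malg_extU prism1_additive). Qed.


Variables (K' L' : scomplex W) (K L : scomplex V) (n : int).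
Hypotheses (cK : contiguous K' K p q) (cL : contiguous L' L p q).

Lemma prism_sub s u : v \in s -> {subset u <= map p s} ->
  {subset [:: p v, q v & u] <= map p s ++ map q s}.
Proof.
move=> vs us y; rewrite !inE mem_cat => /or3P[/eqP ->|/eqP ->|/us ->//].
  by rewrite map_f.
by rewrite orbC map_f.
Qed.

Lemma osimplex_prism (A : scomplex W) (B : scomplex V) m s u :
  contiguous A B p q -> osimplex A (m - 1) s ->
  (size u).+1 = size s -> v \in s -> {subset u <= map p s} ->
  osimplex B m [:: p v, q v & u].
Proof.
move=> cAB sA us vs su; apply: (osimplex_contiguous cAB sA) => //.
  exact: prism_sub.
by case: sA => sz _; rewrite /= us -[in RHS](subrK 1 m) -sz intS addrC.
Qed.

Lemma prism_chain_ochains (A : scomplex W) (B : scomplex V) m c :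
  contiguous A B p q -> c \in ochains A (m - 1) -> prism_chain c \in ochains B m.
Proof.
move=> cAB; apply: (ochains_ind (F := prism_chain)) => s g sA.
rewrite -[_ (mkmalgU s g)]/(prism_chain _) prism_chainU.
apply: rpred_extract => u us vs su.
by apply: mem_ochainsU; exact: (osimplex_prism cAB sA).
Qed.

Lemma prism_chain_class s g : osimplex K' (n - 1) s ->
  (\pi_(Quotient.quot (null_chains K L n)) (prism_chain (mkmalgU s g)))%qT =
  prism v p q (ochain_class K L n g) s.
Proof.
move=> sK; rewrite prism_chainU raddf_extract; apply: eq_extract => u us vs su.
by rewrite /= ochain_classE//; exact: (osimplex_prism cK sK).
Qed.

(** Orientation relations are respected because, modulo null chains, the operator is [prism] of the
    alternating function [ochain_class], which alternates again. *)
Lemma prism_chain_null c : c \in null_chains K' L' (n - 1) ->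
  prism_chain c \in null_chains K L n.
Proof.
move: c; apply: (zspan_map (h := prism_chain) (H := null_chains K L n)) => c.
rewrite -[X in _ -> X \in _]/(prism_chain c).
have alt (g : G) : altfun (prism v p q (ochain_class K L n g)).
  exact/altfun_prism/altfun_ochain_class.
case=> [cL'|[[s [g [sK us ->]]]|[s1 [x [y [s2 [g [sK ->]]]]]]]].
- by apply: mem_zspan; left; exact: prism_chain_ochains cL'.
- by rewrite quot_pi_eq0 prism_chain_class// (altfun_uniq (alt g)).
- rewrite raddfD quot_pi_eq0 raddfD /= !prism_chain_class//; last exact: osimplex_swap.
  by rewrite (alt g).2 addNr.
Qed.

Hypothesis pq : forall x, x != v -> q x = p x.

(** It suffices to treat one simplex [s] and to compare classes modulo null chains. There the order
    of the operators is reversed: the boundary of the prism reads [prism (codiff f) s] and the prism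
    of the boundary reads [codiff (prism f) s], so [prism_homotopy] applies. *)
Lemma prism_chain_homotopy c : c \in ochains K' n ->
  push q c - push p c - bdry (prism_chain c) - prism_chain (bdry c)
    \in null_chains K L n.
Proof.
pose F : {additive malg (seq W) G -> malg (seq V) G} :=
  push q \- push p \- (bdry (G := G) \o prism_chain)
         \- (prism_chain \o bdry (G := G)).
apply: (ochains_ind (F := F)) => s g sK.
rewrite -[_ (mkmalgU s g)]/(push q _ - push p _ - bdry (prism_chain (mkmalgU s g))
                            - prism_chain (bdry _)).
pose f := ochain_class K L n g.
have pushE (r : W -> V) : {subset map r s <= map p s ++ map q s} ->
    (\pi_(Quotient.quot (null_chains K L n)) (push r (mkmalgU s g)))%qT = f (map r s).
  move=> rs; rewrite pushU /f ochain_classE//.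
  apply: (osimplex_contiguous cK sK) => //; last by rewrite size_map; case: sK.
  case: (s) sK => // -[_ /simplices_neq0]; apply: contraNN => _.
  by apply/eqP/fsetP => x; rewrite !inE.
have s0 : s != [::].
  case: (s) sK => // -[_ /simplices_neq0]; apply: contraNN => _.
  by apply/eqP/fsetP => x; rewrite !inE.
have prism_bdry : (\pi_(Quotient.quot (null_chains K L n))
    (bdry (prism_chain (mkmalgU s g))))%qT = prism v p q (codiff f) s.
  rewrite prism_chainU (raddf_extract (bdry (G := G))) raddf_extract.
  apply: eq_extract => u us vs su; rewrite /= bdryU// raddf_codiff.
  apply: eq_codiff => t ts tu; rewrite /f ochain_classE//.
  apply: (osimplex_contiguous cK sK).
  - by rewrite -size_eq0 -eqSS ts.
  - by move=> y /tu; exact: prism_sub.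
  - by move: ts => /= [->]; rewrite us; case: sK.
have bdry_prism : (\pi_(Quotient.quot (null_chains K L n))
    (prism_chain (bdry (mkmalgU s g))))%qT = codiff (prism v p q f) s.
  have [s1|] := ltnP 1 (size s); last first.
    (* For a single vertex [bdry] is 0 by convention, while the augmented [codiff] gives [prism f
       [::]], which is 0 as well. *)
    rewrite /bdry (malg_extU (@bdry1_additive _ _)) /bdry1.
    by case: (s) s0 => [|x [|]]//= _ _; rewrite subr0 !raddf0.
  rewrite bdryU// (raddf_codiff prism_chain) raddf_codiff.
  apply: eq_codiff => u us su; rewrite /= prism_chain_class//.
  have [sz sK'] := sK; split.
    by rewrite subrK; apply/(addIr 1); rewrite -sz -us intS addrC.
  apply: (simplices_sub sK').
    by apply/fsubsetP => x; rewrite !inE; exact: su.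
  case: u us su => [|x u] us su; first by rewrite -us in s1.
  by apply/fset0Pn; exists x; rewrite !inE eqxx.
rewrite quot_pi_eq0 !raddfB/= bdry_prism prism_bdry !pushE.
- rewrite -addrA -opprD [prism _ _ _ _ _ + _]addrC.
  by rewrite prism_homotopy ?subrr//; exact: altfun_ochain_class.
- by move=> x xs; rewrite mem_cat xs.
- by move=> x xs; rewrite mem_cat xs orbT.
Qed.

End PrismChain.

Section ContiguousStep.
Variables (W V : choiceType) (G : zmodType) (n : int) (v : W) (p q : W -> V).
Variables (K' L' : scomplex W) (K L : scomplex V).
Hypotheses (cK : contiguous K' K p q) (cL : contiguous L' L p q).
Hypothesis pq : forall x, x != v -> q x = p x.

Lemma push_contiguous_step (c : malg (seq W) G) : c \in cycles n K' L' ->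
  push q c - push p c \in boundaries n K L.
Proof.
case/andP=> cK' bc; apply/asboolP; exists (prism_chain v p q c).
  by apply: (prism_chain_ochains _ cK); rewrite addrK.
have := prism_chain_homotopy L cK pq cK'.
move/(rpredD (prism_chain_null v cK cL bc)).
by rewrite addrC subrK.
Qed.

Lemma pull_contiguous_step (f : seq V -> G) : f \in cocycles n K L ->
  pull q K' f - pull p K' f \in coboundaries n K' L'.
Proof.
move=> /andP[/asboolP[f1 f2 f3] /eqP f0]; have af := altfunP f2 f3.
(* The prism is cut off outside [K'], since cochains are extended by 0. *)
pose g s := if `[< K' [fset x in s]%fset >] then prism v p q f s else 0.
have ap := altfun_prism v p q af.
apply/asboolP; exists g.
  apply/asboolP; split=> [s|s us|s1 x y s2]; rewrite /g.
  - case: asboolP => [sK|_]; last by rewrite eqxx.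
    (* If [s] has the wrong length or is a simplex of [L'], then the prism over [s] has the wrong
       length or lies in [L], where [f] is 0. *)
    move=> gs; apply: contrapT => /not_andP nos; move/eqP: gs; apply.
    rewrite /prism (@eq_extract _ _ _ _ _ _ (fun=> 0)) ?extract0// => u us vs su.
    apply/eqP/negP => /negP /f1[[uz uK] uL]; case: nos => [nos|/contrapT sL].
      apply: nos; split=> //; rewrite subrK -us.
      by apply/(addIr 1); rewrite -uz addrC -intS.
    by apply: uL; apply: (cL sL) => //; exact: prism_sub.
  - by case: ifP => // _; exact: altfun_uniq.
  - have -> : [fset z in s1 ++ [:: y, x & s2]]%fset =
              [fset z in s1 ++ [:: x, y & s2]]%fset.
      by apply/fsetP => z; rewrite !inE; congr (_ || _); exact: orbCA.
    by case: ifP; rewrite ?oppr0// ap.2.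
apply/funext => s; rewrite -[LHS]/(pull q K' f s - pull p K' f s) /pull /cobdry.
case: asboolP => sK; last by rewrite subr0.
rewrite -codiffE -(prism_homotopy pq)// [X in _ + X](_ : _ = 0) ?addr0.
  (* The cut-off changes no facet of a simplex of [K']: nonempty facets are in [K'], and on the
     empty list the prism is 0 anyway. *)
  apply: eq_codiff => -[//|x u] us su; first by rewrite /g if_same.
  rewrite /g asboolT//; apply: (simplices_sub sK).
    by apply/fsubsetP => y; rewrite !inE; exact: su.
  by apply/fset0Pn; exists x; rewrite !inE eqxx.
(* The prism of [codiff f] vanishes because its lists are simplices of [K], where the cocycle
   condition on [f] applies. *)
rewrite /prism (@eq_extract _ _ _ _ _ _ (fun=> 0)) ?extract0// => u us vs su.
have := congr1 (@^~ [:: p v, q v & u]) f0; rewrite /cobdry asboolT ?codiffE//.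
by apply: (cK sK) => //; exact: prism_sub.
Qed.

End ContiguousStep.

Section Contiguous.
Variables (W V : choiceType) (G : zmodType) (n : int) (p q : W -> V).
Variables (K' L' : scomplex W) (K L : scomplex V).
Hypotheses (cK : contiguous K' K p q) (cL : contiguous L' L p q).

(* Interpolates between p (e empty) and q (e exhausting W) so that consecutive
   maps differ at a single vertex. *)
Definition splice (e : seq W) : W -> V := fun x => if x \in e then q x else p x.

(** At each vertex a splice takes the value of [p] or of [q], so its images bring in no new
    vertices. *)
Lemma contiguous_splice (A : scomplex W) (B : scomplex V) e e' :
  contiguous A B p q -> contiguous A B (splice e) (splice e').
Proof.
move=> pq s t sA t0 ts; apply: (pq _ _ sA t0) => y /ts.
rewrite !mem_cat => /orP[] /mapP[x xs ->]; rewrite /splice; case: ifP => _;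
  by rewrite map_f ?orbT.
Qed.

Lemma splice_cons v e x : x != v -> splice (v :: e) x = splice e x.
Proof. by rewrite /splice inE => /negPf ->. Qed.

Lemma push_splice e (c : malg (seq W) G) : c \in cycles n K' L' ->
  push (splice e) c - push p c \in boundaries n K L.
Proof.
move=> cc; elim: e => [|v e IH].
  by rewrite (_ : splice [::] = p) ?subrr ?rpred0//; apply/funext.
have step : push (splice (v :: e)) c - push (splice e) c \in boundaries n K L.
  apply: (push_contiguous_step (v := v)) cc; first exact: contiguous_splice.
    exact: contiguous_splice.
  by move=> x; exact: splice_cons.
by have := rpredD step IH; rewrite addrA subrK.
Qed.

Lemma pull_splice e (f : seq V -> G) : f \in cocycles n K L ->
  pull (splice e) K' f - pull p K' f \in coboundaries n K' L'.
Proof.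
move=> ff; elim: e => [|v e IH].
  by rewrite (_ : splice [::] = p) ?subrr ?rpred0//; apply/funext.
have step : pull (splice (v :: e)) K' f - pull (splice e) K' f
    \in coboundaries n K' L'.
  apply: (pull_contiguous_step (v := v)) ff; first exact: contiguous_splice.
    exact: contiguous_splice.
  by move=> x; exact: splice_cons.
by have := rpredD step IH; rewrite addrA subrK.
Qed.

Hypothesis finW : exists e : seq W, forall x, x \in e.
Hypothesis pK : forall s, K' s -> K [fset p v | v in s]%fset.
Hypothesis pL : forall s, L' s -> L [fset p v | v in s]%fset.
Hypothesis qK : forall s, K' s -> K [fset q v | v in s]%fset.
Hypothesis qL : forall s, L' s -> L [fset q v | v in s]%fset.

Let splice_full e : (forall x, x \in e) -> splice e = q.
Proof. by move=> eW; apply/funext => x; rewrite /splice eW. Qed.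

Lemma homology_map_contiguous :
  homology_map G n qK qL =1 homology_map G n pK pL.
Proof.
have [e /splice_full eq] := finW.
move=> x; rewrite -[x]reprK -[(\pi _)%qT]/(subquot_pi _ (repr x)) !subquot_mapE.
apply/eqP; rewrite subquot_piE /=.
by have := push_splice e (valP (repr x)); rewrite eq.
Qed.

Lemma cohomology_map_contiguous :
  cohomology_map G n qK qL =1 cohomology_map G n pK pL.
Proof.
have [e /splice_full eq] := finW.
move=> x; rewrite -[x]reprK -[(\pi _)%qT]/(subquot_pi _ (repr x)) !subquot_mapE.
apply/eqP; rewrite subquot_piE /=.
by have := pull_splice e (valP (repr x)); rewrite eq.
Qed.

End Contiguous.

(** * Limits over mutually cofinal systems *)

Lemma sum_uniq_support (J : eqType) (M : zmodType) (s s' : seq J) (F : J -> M) :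
  uniq s -> uniq s' -> (forall j, F j != 0 -> j \in s /\ j \in s') ->
  \sum_(j <- s) F j = \sum_(j <- s') F j.
Proof.
move=> us us' Fs.
rewrite (bigID (fun j => F j == 0)) /= big1 ?add0r; last by move=> j /eqP.
rewrite [RHS](bigID (fun j => F j == 0)) /= [X in _ = X + _]big1 ?add0r;
  last by move=> j /eqP.
rewrite -[LHS]big_filter -[RHS]big_filter; apply: perm_big.
apply: uniq_perm; rewrite ?filter_uniq// => j.
by rewrite !mem_filter; case: eqP => //= /eqP /Fs[-> ->].
Qed.

Lemma subquot_lift (V N : zmodType) (Z B : zmodClosed V) (T : {additive zsub Z -> N}) :
  (forall x, val x \in B -> T x = 0) ->
  exists Phi : {additive subquot Z B -> N}, forall x, Phi (subquot_pi B x) = T x.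
Proof.
move=> TB; pose Phi (x : subquot Z B) : N := T (repr x).
have PhiE x : Phi (subquot_pi B x) = T x.
  apply/eqP; rewrite -subr_eq0 -raddfB TB// raddfB -subquot_piE.
  by rewrite /subquot_pi reprK.
have PhiB : zmod_morphism Phi.
  move=> x y; rewrite -[x]reprK -[y]reprK -![(\pi _)%qT]/(subquot_pi B _).
  by rewrite -raddfB !PhiE raddfB.
pose Phi' : {additive _ -> _} :=
  HB.pack Phi (GRing.isZmodMorphism.Build _ _ Phi PhiB).
by exists Phi'.
Qed.

(** * The universal property of the direct limit *)

Section DirectLimit.
Variables (J : eqType) (arr : J -> J -> Type) (M : J -> zmodType).
Variable f : forall i j, arr i j -> {additive M i -> M j}.

Lemma dinjE j (x : M j) : dinj x j = x.
Proof. by rewrite /dinj dfwith_in. Qed.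

Lemma dinj_out j (x : M j) k : k != j -> dinj x k = 0.
Proof. by move=> kj; rewrite /dinj dfwith_out// eq_sym. Qed.

Lemma dinj_additive j : zmod_morphism (@dinj J M j).
Proof.
move=> x y; apply: functional_extensionality_dep => k; rewrite dprodBE.
by have [->|kj] := eqVneq k j; rewrite ?dinjE ?dinj_out// subr0.
Qed.

Lemma finsupp_dinj j (x : M j) : dinj x \in finsupp_fam (M := M).
Proof.
apply/asboolP; apply: (sub_finite_set _ (finite_set1 j)) => k /=.
by have [//|kj] := eqVneq k j; rewrite dinj_out ?eqxx.
Qed.

Definition dinj_fam j (x : M j) : zsub (finsupp_fam (M := M)) :=
  exist _ (dinj x) (finsupp_dinj x).

Definition dirlim_in j (x : M j) : dirlim f := subquot_pi _ (dinj_fam x).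

Lemma dirlim_in_additive j : zmod_morphism (@dirlim_in j).
Proof.
move=> x y; rewrite /dirlim_in -raddfB; congr subquot_pi; apply: val_inj.
by rewrite raddfB /= dinj_additive.
Qed.

HB.instance Definition _ j :=
  GRing.isZmodMorphism.Build _ _ (@dirlim_in j) (@dirlim_in_additive j).

Lemma dirlim_in_bonding i j (a : arr i j) x : dirlim_in (f a x) = dirlim_in x.
Proof.
apply/esym/eqP; rewrite subquot_piE; apply: mem_zspan.
by exists i, j, a, x.
Qed.

Lemma finsupp_famP (z : dprod M) : z \in finsupp_fam (M := M) ->
  exists2 s : seq J, uniq s & forall j, z j != 0 -> j \in s.
Proof.
move=> /asboolP /finite_seqP[s zs]; exists (undup s); first exact: undup_uniq.
by move=> j zj; rewrite mem_undup; have : [set` s] j by rewrite -zs.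
Qed.

Lemma dirlim_ext (N : zmodType) (g g' : {additive dirlim f -> N}) :
  (forall i (x : M i), g (dirlim_in x) = g' (dirlim_in x)) -> g =1 g'.
Proof.
move=> gg' z; rewrite -[z]reprK -![(\pi _)%qT]/(subquot_pi _ (repr z)).
move: (repr z) => w; have [s us ws] := finsupp_famP (valP w).
suff -> : w = \sum_(j <- s) dinj_fam (val w j).
  by rewrite !raddf_sum; apply: eq_bigr => j _; exact: gg'.
apply: val_inj; rewrite raddf_sum /=; apply: functional_extensionality_dep => k.
have ev (F : J -> dprod M) : (\sum_(j <- s) F j) k = \sum_(j <- s) F j k.
  exact: (big_morph (fun z : dprod M => z k)).
rewrite ev; have [ks|ks] := boolP (k \in s).
  rewrite (big_rem k)//= dinjE big_seq big1 ?addr0// => j.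
  by rewrite mem_rem_uniq// inE => /andP[jk _]; rewrite dinj_out// eq_sym.
rewrite big_seq big1 => [|j js]; last by rewrite dinj_out//; apply: contraNneq ks => ->.
by apply/eqP; apply: contraNT ks => /ws.
Qed.

Lemma dirlim_lift (N : zmodType) (g : forall i, {additive M i -> N}) :
  (forall i j (a : arr i j) x, g j (f a x) = g i x) ->
  exists Phi : {additive dirlim f -> N},
    forall i (x : M i), Phi (dirlim_in x) = g i x.
Proof.
move=> gf.
(* A support list is chosen where one exists; the default [[::]] only makes [tot] total, and
   additivity is claimed on finitely supported families alone. *)
pose supp (z : dprod M) : seq J :=
  if pselect (exists s : seq J, uniq s /\ forall j, z j != 0 -> j \in s) is left h
  then sval (cid h) else [::].
pose tot (z : dprod M) : N := \sum_(j <- supp z) g j (z j).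
have totE z s : uniq s -> (forall j, z j != 0 -> j \in s) ->
    tot z = \sum_(j <- s) g j (z j).
  move=> us zs; rewrite /tot /supp; case: pselect => [h|]; last by case; exists s.
  have [uh zh] := svalP (cid h); apply: sum_uniq_support => // j gj.
  have zj : z j != 0 by apply: contraNneq gj => ->; rewrite raddf0.
  by split; [exact: zh|exact: zs].
have totB (y z : dprod M) : y \in finsupp_fam (M := M) -> z \in finsupp_fam (M := M) ->
    tot (y - z) = tot y - tot z.
  move=> /finsupp_famP[s us ys] /finsupp_famP[t ut zt].
  have ust : uniq (undup (s ++ t)) by exact: undup_uniq.
  have yst j : y j != 0 -> j \in undup (s ++ t).
    by rewrite mem_undup mem_cat => /ys ->.
  have zst j : z j != 0 -> j \in undup (s ++ t).
    by rewrite mem_undup mem_cat => /zt ->; rewrite orbT.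
  rewrite (totE _ _ ust yst) (totE _ _ ust zst) (totE _ _ ust) => [|j].
    by rewrite -sumrB; apply: eq_bigr => j _; rewrite dprodBE raddfB.
  rewrite dprodBE; have [->|/yst//] := eqVneq (y j) 0.
  by rewrite sub0r oppr_eq0 => /zst.
have tot_dinj i (x : M i) : tot (dinj x) = g i x.
  rewrite (totE _ [:: i])// ?big_seq1 ?dinjE// => j.
  by have [->|ji] := eqVneq j i; rewrite ?mem_head// dinj_out ?eqxx.
(* To show that [tot] kills the span of the relations, a subgroup of [dprod M] containing them is
   needed. Finite support is built in because [tot] is additive only there. *)
pose Z : {pred dprod M} := fun z => (z \in finsupp_fam (M := M)) && (tot z == 0).
have Zcl : zmod_closed Z.
  split=> [|y z /andP[yf /eqP y0] /andP[zf /eqP z0]]; apply/andP; split.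
  - exact: rpred0.
  - by rewrite (totE _ [::])// ?big_nil// => j; rewrite eqxx.
  - exact: rpredB.
  - by rewrite totB// y0 z0 subr0.
pose Zc : zmodClosed (dprod M) :=
  HB.pack Z (GRing.isZmodClosed.Build (dprod M) Z Zcl).
pose T0 (w : zsub (finsupp_fam (M := M))) : N := tot (val w).
have T0B : zmod_morphism T0.
  by move=> y z; rewrite /T0 raddfB totB//; exact: valP.
pose T : {additive _ -> _} := HB.pack T0 (GRing.isZmodMorphism.Build _ _ T0 T0B).
have [|Phi PhiE] := @subquot_lift _ _ _ (zspan (dirlim_rel f)) T.
  move=> w /asboolP /(_ Zc) H; suff /andP[_ /eqP] : val w \in Zc by [].
  apply: H => _ [i [j [a [x ->]]]]; apply/andP; split.
    by rewrite rpredB ?finsupp_dinj.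
  by rewrite totB ?finsupp_dinj// !tot_dinj gf subrr.
by exists Phi => i x; rewrite PhiE; exact: tot_dinj.
Qed.

End DirectLimit.

(** * Two systems over a common category-like structure of refinements *)

Section Interleaving.
Variables (P : Type) (arr : P -> P -> Type) (small : P -> Prop).
Variable comp : forall a b c, arr a b -> arr b c -> arr a c.

(** An arrow from [a] to [b] stands for a refinement of [a] by [b], and small objects for finite
    covers. Parallel arrows are only known to agree when their target is small, hence common
    refinements are required to be small; individual members of the system may be infinite
    covers. *)
Record system := System {
  sys_idx : eqType;
  sys_arr : sys_idx -> sys_idx -> Type;
  sys_obj : sys_idx -> P;
  sys_mor : forall i j, sys_arr i j -> arr (sys_obj i) (sys_obj j);
  sys_dir : forall i j, exists k (a : sys_arr i k) (b : sys_arr j k),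
    small (sys_obj k)
}.

Definition cofinal_in (S T : system) :=
  forall i : sys_idx T, exists (j : sys_idx S), inhabited (arr (sys_obj i) (sys_obj j)).

Section Inverse.
Variables (H : P -> zmodType) (h : forall a b, arr a b -> {additive H b -> H a}).
Hypothesis h_comp : forall a b c (f : arr a b) (g : arr b c) x,
  h (comp f g) x = h f (h g x).
Hypothesis h_thin : forall a b (f g : arr a b), small b -> h f =1 h g.

Definition inv_bonding (S : system) := forall i j : sys_idx S,
  sys_arr i j -> {additive H (sys_obj j) -> H (sys_obj i)}.

Definition inv_bonding_by_h (S : system) (f : inv_bonding S) :=
  forall i j (a : sys_arr i j), f i j a =1 h (sys_mor a).

(** Both components come from a common small refinement, and all arrows from [a] into it induce the
    same map. Consequently the families built in [invlim_map] do not depend on the chosen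
    refinements, which gives both their compatibility and the formula for every [q]. *)
Lemma invlim_coherent (S : system) (f : inv_bonding S) (fE : inv_bonding_by_h f)
    (x : invlim f) a j j' (q : arr a (sys_obj j)) (q' : arr a (sys_obj j')) :
  h q (val x j) = h q' (val x j').
Proof.
have [k [b [b' sk]]] := sys_dir j j'.
have /asboolP cx := valP x.
rewrite -(cx _ _ b) -(cx _ _ b') !fE -!h_comp.
exact: h_thin.
Qed.

Lemma invlim_map (S T : system) (f : inv_bonding S) (g : inv_bonding T) :
  inv_bonding_by_h f -> inv_bonding_by_h g ->
  cofinal_in S T ->
  exists Phi : {additive invlim f -> invlim g},
    forall x i j (q : arr (sys_obj i) (sys_obj j)), val (Phi x) i = h q (val x j).
Proof.
move=> fE gE ST; pose c i := cid (ST i).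
have q i : arr (sys_obj i) (sys_obj (sval (c i))).
  exact: inhabited_witness (svalP (c i)).
pose y (x : invlim f) : dprod (fun i : sys_idx T => H (sys_obj i)) :=
  fun i => h (q i) (val x (sval (c i))).
have yP x : y x \in compatible g.
  apply/asboolP => i j a; rewrite gE /y -h_comp.
  exact: (invlim_coherent fE).
pose Phi (x : invlim f) : invlim g := exist _ (y x) (yP x).
have PhiB : zmod_morphism Phi.
  move=> u v; apply: val_inj; apply: functional_extensionality_dep => i.
  by rewrite raddfB /= /y raddfB.
pose Phi' : {additive _ -> _} :=
  HB.pack Phi (GRing.isZmodMorphism.Build _ _ Phi PhiB).
exists Phi' => x i j q'.
exact: (invlim_coherent fE).
Qed.

Lemma invlim_isomorphic (S T : system) (f : inv_bonding S) (g : inv_bonding T) :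
  inv_bonding_by_h f -> inv_bonding_by_h g ->
  cofinal_in S T -> cofinal_in T S ->
  zmod_isomorphic (invlim f) (invlim g).
Proof.
move=> fE gE ST TS; have [Phi PhiE] := invlim_map fE gE ST.
have [Psi PsiE] := invlim_map gE fE TS.
exists Phi; exists Psi => x; apply: val_inj; apply: functional_extensionality_dep => i.
  have [j [r]] := TS i; have [k [q]] := ST j.
  rewrite (PsiE _ _ _ r) (PhiE _ _ _ q) -h_comp.
  (* No identity arrow is available to apply [invlim_coherent] at [i] itself, so the components at
     [i] and [k] are both written through a small common refinement [l]. *)
  have [l [b [b' sl]]] := sys_dir i k; have /asboolP cx := valP x.
  by rewrite -(cx _ _ b) -(cx _ _ b') !fE -!h_comp; exact: h_thin.
have [j [r]] := ST i; have [k [q]] := TS j.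
rewrite (PhiE _ _ _ r) (PsiE _ _ _ q) -h_comp.
have [l [b [b' sl]]] := sys_dir i k; have /asboolP cx := valP x.
by rewrite -(cx _ _ b) -(cx _ _ b') !gE -!h_comp; exact: h_thin.
Qed.

End Inverse.

Section Direct.
Variables (H : P -> zmodType) (h : forall a b, arr a b -> {additive H a -> H b}).
Hypothesis h_comp : forall a b c (f : arr a b) (g : arr b c) x,
  h (comp f g) x = h g (h f x).
Hypothesis h_thin : forall a b (f g : arr a b), small b -> h f =1 h g.

Definition dir_bonding (S : system) := forall i j : sys_idx S,
  sys_arr i j -> {additive H (sys_obj i) -> H (sys_obj j)}.

Definition dir_bonding_by_h (S : system) (f : dir_bonding S) :=
  forall i j (a : sys_arr i j), f i j a =1 h (sys_mor a).

Lemma dirlim_map (S T : system) (f : dir_bonding S) (g : dir_bonding T) :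
  dir_bonding_by_h f -> dir_bonding_by_h g ->
  cofinal_in T S ->
  exists Phi : {additive dirlim f -> dirlim g},
    forall i j (q : arr (sys_obj i) (sys_obj j)) x,
      Phi (dirlim_in f x) = dirlim_in g (h q x).
Proof.
move=> fE gE TS; pose c i := cid (TS i).
have q i : arr (sys_obj i) (sys_obj (sval (c i))).
  exact: inhabited_witness (svalP (c i)).
have coh i j j' (r : arr (sys_obj i) (sys_obj j)) (r' : arr (sys_obj i) (sys_obj j')) x :
    dirlim_in g (h r x) = dirlim_in g (h r' x).
  have [k [b [b' sk]]] := sys_dir j j'.
  rewrite -(dirlim_in_bonding _ b) -(dirlim_in_bonding _ b').
  by rewrite !gE -!h_comp; congr dirlim_in; exact: h_thin.
have [|Phi PhiE] := @dirlim_lift _ _ _ f _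
    (fun i => @dirlim_in _ _ _ g _ \o h (q i)).
  move=> i j a x /=; rewrite fE -h_comp; exact: coh.
by exists Phi => i j r x; rewrite PhiE; exact: coh.
Qed.

Lemma dirlim_isomorphic (S T : system) (f : dir_bonding S) (g : dir_bonding T) :
  dir_bonding_by_h f -> dir_bonding_by_h g ->
  cofinal_in S T -> cofinal_in T S ->
  zmod_isomorphic (dirlim f) (dirlim g).
Proof.
move=> fE gE ST TS; have [Phi PhiE] := dirlim_map fE gE TS.
have [Psi PsiE] := dirlim_map gE fE ST.
exists Phi; exists Psi.
  apply: (dirlim_ext (g := Psi \o Phi) (g' := idfun)) => i x /=.
  have [j [r]] := TS i; have [k [q]] := ST j.
  rewrite (PhiE _ _ r) (PsiE _ _ q) -h_comp.
  have [l [b [b' sl]]] := sys_dir i k.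
  rewrite -(dirlim_in_bonding _ b) -(dirlim_in_bonding _ b').
  by rewrite !fE -!h_comp; congr dirlim_in; exact: h_thin.
apply: (dirlim_ext (g := Phi \o Psi) (g' := idfun)) => i x /=.
have [j [r]] := ST i; have [k [q]] := TS j.
rewrite (PsiE _ _ r) (PhiE _ _ q) -h_comp.
have [l [b [b' sl]]] := sys_dir i k.
rewrite -(dirlim_in_bonding _ b) -(dirlim_in_bonding _ b').
by rewrite !gE -!h_comp; congr dirlim_in; exact: h_thin.
Qed.

End Direct.
End Interleaving.

(** * Nerves and refinements *)

Lemma subquot_pi_surj (V : zmodType) (Z B : zmodClosed V) (x : subquot Z B) :
  exists y, x = subquot_pi B y.
Proof. by exists (repr x); rewrite /subquot_pi reprK. Qed.

Section Composition.
Variables (U W V : choiceType) (G : zmodType) (n : int) (q : U -> W) (p : W -> V).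
Variables (K2 L2 : scomplex U) (K1 L1 : scomplex W) (K L : scomplex V).
Hypothesis qK : forall s, K2 s -> K1 [fset q v | v in s]%fset.
Hypothesis qL : forall s, L2 s -> L1 [fset q v | v in s]%fset.
Hypothesis pK : forall s, K1 s -> K [fset p v | v in s]%fset.
Hypothesis pL : forall s, L1 s -> L [fset p v | v in s]%fset.
Hypothesis pqK : forall s, K2 s -> K [fset (p \o q) v | v in s]%fset.
Hypothesis pqL : forall s, L2 s -> L [fset (p \o q) v | v in s]%fset.

Lemma homology_map_comp x :
  homology_map G n pqK pqL x = homology_map G n pK pL (homology_map G n qK qL x).
Proof.
have [y ->] := subquot_pi_surj x.
rewrite [homology_map G n qK qL _]subquot_mapE !subquot_mapE.
congr subquot_pi; apply: val_inj.
suff push_comp : push (p \o q) =1 push p \o push q (G := G).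
  exact: (push_comp (val y)).
by apply: malg_additive_eq => s g /=; rewrite !pushU map_comp.
Qed.

Lemma cohomology_map_comp x :
  cohomology_map G n pqK pqL x =
  cohomology_map G n qK qL (cohomology_map G n pK pL x).
Proof.
have [y ->] := subquot_pi_surj x.
rewrite [cohomology_map G n pK pL _]subquot_mapE !subquot_mapE.
congr subquot_pi; apply: val_inj; apply/funext => s /=; rewrite /pull.
case: asboolP => // sK; rewrite map_comp asboolT//.
have -> : [fset x in map q s]%fset = [fset q v | v in [fset x in s]]%fset.
  apply/fsetP => z; rewrite !inE; apply/mapP/imfsetP => -[u us ->];
    by exists u => //; rewrite inE in us *.
exact: qK.
Qed.

End Composition.

Section Covers.
Variables (X : Type) (A : set X).

(* The complexes are only required to have the same simplices as the nerves, so
   that a cover of bX, restricted to X, can carry its own nerves. *)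
Record nerve_pair := NervePair {
  np_idx : choiceType;
  np_set : np_idx -> set X;
  np_abs : scomplex np_idx;
  np_sub : scomplex np_idx;
  np_absP : forall s, np_abs s <-> nerve np_set setT s;
  np_subP : forall s, np_sub s <-> nerve np_set A s
}.

Definition refinement (a b : nerve_pair) :=
  {p : np_idx b -> np_idx a | forall v, np_set v `<=` np_set (p v)}.

Lemma refinement_compP a b c (f : refinement a b) (g : refinement b c) v :
  np_set v `<=` np_set ((sval f \o sval g) v).
Proof. exact: subset_trans (svalP g v) (svalP f _). Qed.

Definition refinement_comp a b c (f : refinement a b) (g : refinement b c) :
  refinement a c := exist _ (sval f \o sval g) (refinement_compP f g).

Definition finite_nerve (a : nerve_pair) :=
  exists e : seq (np_idx a), forall v, v \in e.

(** A point of [B] common to the members indexed by [s] also lies in all members of the coarser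
    cover that [f] and [g] assign to [s]. *)
Lemma refinement_contiguous (a b : nerve_pair) (f g : refinement a b) (B : set X)
    (K' : scomplex (np_idx b)) (K : scomplex (np_idx a)) :
  (forall s, K' s <-> nerve (@np_set b) B s) ->
  (forall s, K s <-> nerve (@np_set a) B s) ->
  contiguous K' K (sval f) (sval g).
Proof.
move=> K'P KP s t /K'P[_ [x [Bx sx]]] t0 ts; apply/KP; split.
  by case: t t0 ts => // y t _ _; apply/fset0Pn; exists y; rewrite !inE eqxx.
exists x; split=> // y; rewrite /= inE => /ts.
rewrite mem_cat => /orP[] /mapP[v vs ->].
  by apply: (svalP f); apply: sx; rewrite /= inE.
by apply: (svalP g); apply: sx; rewrite /= inE.
Qed.

Lemma contiguous_simplicial (W V : choiceType) (K' : scomplex W) (K : scomplex V)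
    (p : W -> V) : contiguous K' K p p ->
  forall s, K' s -> K [fset p v | v in s]%fset.
Proof.
move=> cK s sK.
have -> : [fset p v | v in s]%fset = [fset y in map p (enum_fset s)]%fset.
  apply/fsetP => y; rewrite !inE; apply/imfsetP/mapP => -[x xs ->];
    by exists x.
apply: (cK (enum_fset s)).
- by rewrite (_ : [fset x in _]%fset = s)//; apply/fsetP => x; rewrite !inE.
- have /fset0Pn[x xs] := simplices_neq0 sK.
  by apply/eqP => /(congr1 (fun t => p x \in t)); rewrite map_f.
- by move=> y ys; rewrite mem_cat ys.
Qed.

Definition refinement_abs a b (f : refinement a b) :=
  contiguous_simplicial (refinement_contiguous (f := f) (g := f)
    (@np_absP b) (@np_absP a)).
Definition refinement_sub a b (f : refinement a b) :=
  contiguous_simplicial (refinement_contiguous (f := f) (g := f)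
    (@np_subP b) (@np_subP a)).

Variables (G : zmodType) (n : int).

Definition np_homology (a : nerve_pair) : zmodType :=
  homology G n (np_abs a) (np_sub a).

Definition refinement_homology a b (f : refinement a b) :
    {additive np_homology b -> np_homology a} :=
  homology_map G n (refinement_abs f) (refinement_sub f).

Definition np_cohomology (a : nerve_pair) : zmodType :=
  cohomology G n (np_abs a) (np_sub a).

Definition refinement_cohomology a b (f : refinement a b) :
    {additive np_cohomology a -> np_cohomology b} :=
  cohomology_map G n (refinement_abs f) (refinement_sub f).

Lemma refinement_homology_thin a b (f g : refinement a b) : finite_nerve b ->
  refinement_homology f =1 refinement_homology g.
Proof.
move=> fb; apply: homology_map_contiguous => //.
  exact: refinement_contiguous (@np_absP b) (@np_absP a).
exact: refinement_contiguous (@np_subP b) (@np_subP a).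
Qed.

Lemma refinement_cohomology_thin a b (f g : refinement a b) : finite_nerve b ->
  refinement_cohomology f =1 refinement_cohomology g.
Proof.
move=> fb; apply: cohomology_map_contiguous => //.
  exact: refinement_contiguous (@np_absP b) (@np_absP a).
exact: refinement_contiguous (@np_subP b) (@np_subP a).
Qed.

Lemma refinement_homology_comp a b c (f : refinement a b) (g : refinement b c) x :
  refinement_homology (refinement_comp f g) x =
  refinement_homology f (refinement_homology g x).
Proof. exact: homology_map_comp. Qed.

Lemma refinement_cohomology_comp a b c (f : refinement a b) (g : refinement b c) x :
  refinement_cohomology (refinement_comp f g) x =
  refinement_cohomology g (refinement_cohomology f x).
Proof. exact: cohomology_map_comp. Qed.

End Covers.

(** * Functionally open sets and compactness *)

Lemma compact_set_type (T : topologicalType) (A : set T) :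
  compact A -> compact [set: A].
Proof.
move=> cA F FF _.
have [|x [Ax Fx]] := cA (set_val @ F) (fmap_proper_filter set_val FF).
  by apply: (@filterE _ F) => y; exact: set_valP.
exists (exist _ x (mem_set Ax)); split=> // P Q FP [_ [[W oW <-] Wx WQ]].
have [||y [[z Pz zy] Wy]] := Fx (set_val @` P) W.
- by apply: (@filterS _ F _ P) FP => z Pz; exists z.
- exact: open_nbhs_nbhs.
- by exists z; split=> //; apply: WQ; rewrite /= zy.
Qed.

Lemma hausdorff_set_type (T : topologicalType) (A : set T) :
  hausdorff_space T -> hausdorff_space A.
Proof.
move=> hT x y xy; apply: val_inj; apply: hT => P Q xP yQ.
have [z [Pz Qz]] := xy _ _ (initial_continuous xP) (initial_continuous yQ).
by exists (set_val z).
Qed.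

Lemma continuous_set_type (S T : topologicalType) (A : set T) (f : S -> A) :
  continuous (set_val \o f) -> continuous f.
Proof.
move=> cf x P [_ [[W oW <-] Wx WP]].
have : nbhs x ((set_val \o f) @^-1` W) by apply: cf; exact: open_nbhs_nbhs.
by apply: filterS => y Wy; exact: WP.
Qed.

Lemma finite_subcover (T : topologicalType) (C : set (set T)) :
  compact [set: T] -> (forall U, C U -> open U) ->
  (forall x, exists2 U, C U & U x) ->
  exists2 E : seq (set T), (forall U, U \in E -> C U) &
    forall x, exists2 U, U \in E & U x.
Proof.
(* [compact_cover] is applied to a pointed space, so the empty space is treated apart, with the
   empty subcover. *)
move=> cT oC covC; have [[x0]|T0] := pselect (inhabited T); last first.
  by exists [::] => // x; case: T0; exists.
pose pT : ptopologicalType := HB.pack T (isPointed.Build T x0).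
have : compact [set: pT] := cT; rewrite compact_cover.
move=> /(_ (set T) C id oC)[x _|E EC covE]; first by have [U CU Ux] := covC x; exists U.
exists (enum_fset E) => [U /EC /set_mem//|x].
by have [U UE Ux] := covE x I; exists U.
Qed.

Lemma closure_meets (T X : topologicalType) (i : X -> T) (B : set X) (O : set T) :
  open O -> closure (i @` B) `&` O !=set0 <-> B `&` i @^-1` O !=set0.
Proof.
move=> oO; split=> [[z [Bz Oz]]|[x [Bx Ox]]].
  have [_ [[x Bx <-] Ox]] := Bz _ (open_nbhs_nbhs (conj oO Oz)).
  by exists x.
by exists (i x); split=> //; apply: subset_closure; exists x.
Qed.

Lemma open_bigcap_fset (T : topologicalType) (I : choiceType) (s : {fset I})
    (U : I -> set T) :
  (forall v, open (U v)) -> open (\bigcap_(v in [set` s]) U v).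
Proof.
move=> oU; rewrite bigcap_fset; elim/big_ind: _ => //; first exact: openT.
exact: openI.
Qed.

Lemma range_unit (R : realType) (T : Type) (f : T -> R) :
  range f `<=` `[0, 1] -> forall x, 0 <= f x <= 1.
Proof.
by move=> f01 x; have := f01 (f x) (ex_intro2 _ _ x I erefl); rewrite /= in_itv.
Qed.

Section FunctionallyOpen.
Variables (R : realType) (X : topologicalType).

Lemma functionally_openI (U V : set X) : functionally_open R U ->
  functionally_open R V -> functionally_open R (U `&` V).
Proof.
move=> [f [cf f01 ->]] [g [cg g01 ->]]; exists (fun x => f x * g x).
have f1 := range_unit f01; have g1 := range_unit g01.
have fg1 x : 0 <= f x * g x <= 1.
  by have /andP[? ?] := f1 x; have /andP[? ?] := g1 x; rewrite mulr_ge0// mulr_ile1.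
split.
- by move=> x; exact: (continuousM (cf x) (cg x)).
- by move=> _ [x _ <-]; rewrite /= in_itv; exact: fg1.
- apply/seteqP; split=> x /=; rewrite !in_itv/=.
    by case=> /andP[f0 _] /andP[g0 _]; rewrite mulr_gt0//; case/andP: (fg1 x).
  move=> /andP[fg0 _]; have /andP[f0 ->] := f1 x; have /andP[g0 ->] := g1 x.
  rewrite !andbT !lt_neqAle f0 g0 !andbT ![0 == _]eq_sym.
  by apply/andP; rewrite -negb_or -mulf_eq0; rewrite gt_eqF.
Qed.

Lemma functionally_open_open (U : set X) : functionally_open R U -> open U.
Proof.
move=> [f [cf f01 ->]].
have -> : f @^-1` `]0, 1] = f @^-1` [set r | 0 < r].
  apply/seteqP; split=> x /=; rewrite in_itv/=; first by case/andP.
  move=> ->/=.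
  by have /andP[] := range_unit f01 x.
apply: open_comp (@open_gt R 0) => x _; exact: cf.
Qed.

End FunctionallyOpen.

Lemma functionally_open_preimage (R : realType) (X Y : topologicalType)
    (i : X -> Y) (U : set Y) :
  continuous i -> functionally_open R U -> functionally_open R (i @^-1` U).
Proof.
move=> ci [f [cf f01 ->]]; exists (f \o i); split=> //.
  by move=> x; apply: continuous_comp; [exact: ci|exact: cf].
by move=> _ [x _ <-]; apply: f01; exists (i x).
Qed.

Lemma compact_functional_nbhs (R : realType) (T : topologicalType) (x : T) (W : set T) :
  compact [set: T] -> hausdorff_space T -> open W -> W x ->
  exists2 U, functionally_open R U /\ U `<=` W & U x.
Proof.
move=> cT hT oW Wx.
have crT : completely_regular_space T.
  apply: (@normal_completely_regular R).
    exact: compact_normal.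
  exact: hausdorff_accessible.
have /(uniform_separatorP (R := R))[f [cf f01 fx fW]] :
    uniform_separator [set x] (~` W).
  by apply: crT; [exact: open_closedC|exact].
have f1 := range_unit f01.
(* The separating function is 0 at [x] and 1 off [W], so [1 - f] is positive at [x] and only inside
   [W]. *)
exists ((fun y => 1 - f y) @^-1` `]0, 1]); last first.
  have fx0 : f x = 0 by apply: fx; exists x.
  by rewrite /= in_itv/= fx0 subr0 ltr01 lexx.
split.
  exists (fun y => 1 - f y); split=> //.
    by move=> y; apply: continuousB; [exact: cvg_cst|exact: cf].
  by move=> _ [y _ <-]; rewrite /= in_itv/= subr_ge0 lerBlDr lerDl andbC.
move=> y /=; rewrite in_itv/= => /andP[f0 _]; apply: contrapT => nWy.
by move: f0; rewrite (fW (f y)) ?subrr ?ltxx//; exists y.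
Qed.

(** * The two systems of covers of X and their mutual cofinality *)

Section FunctionalSystem.
Variables (R : realType) (X : topologicalType) (A : set X).

Definition fo_pair (c : fo_cover R X) : nerve_pair A :=
  NervePair (fun s => iff_refl (nerve (@fo_set R X c) setT s))
            (fun s => iff_refl (nerve (@fo_set R X c) A s)).

Definition fo_mor (c d : fo_cover R X) (p : projection (@fo_set R X) c d) :
  refinement (fo_pair c) (fo_pair d) := p.

Lemma fo_dir (c d : fo_cover R X) :
  exists e (p : projection (@fo_set R X) c e) (q : projection (@fo_set R X) d e),
    finite_nerve (fo_pair e).
Proof.
pose T : finType := ('I_(fo_size c) * 'I_(fo_size d))%type.
pose U (k : 'I_#|T|) := fo_set (enum_val k).1 `&` fo_set (enum_val k).2.
have UP k : functionally_open R (U k).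
  by apply: functionally_openI; exact: fo_setP.
have UT : \bigcup_k U k = setT.
  rewrite -subTset => x _.
  have [u _ ux] : (\bigcup_v @fo_set R X c v) x by rewrite fo_setT.
  have [v _ vx] : (\bigcup_v @fo_set R X d v) x by rewrite fo_setT.
  by exists (enum_rank ((u, v) : T)) => //; rewrite /U enum_rankK.
exists (FOCover UP UT).
have pP k : U k `<=` fo_set (enum_val k).1 by move=> x [].
have qP k : U k `<=` fo_set (enum_val k).2 by move=> x [].
exists (exist _ _ pP), (exist _ _ qP).
by exists (enum 'I_#|T|) => v; rewrite mem_enum.
Qed.

Definition fo_system : system (@refinement X A) (@finite_nerve X A) :=
  System fo_mor fo_dir.

End FunctionalSystem.

Section CechSystem.
Variables (X bX : topologicalType) (i : X -> bX) (A : set X).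
Hypothesis i_dense : closure (range i) = setT.
Hypothesis bX_compact : compact [set: bX].

Lemma nerve_closure (D : open_cover bX) (B : set X) s :
  nerve (@oc_set bX D) (closure (i @` B)) s <->
  nerve (fun v => i @^-1` @oc_set bX D v) B s.
Proof.
have oD : open (\bigcap_(v in [set` s]) @oc_set bX D v).
  by apply: open_bigcap_fset => v; exact: oc_open (set_valP v).
have := closure_meets i B oD; rewrite preimage_bigcap => cm.
by split=> -[s0 /cm].
Qed.

Lemma nerve_dense (D : open_cover bX) s :
  nerve (@oc_set bX D) setT s <-> nerve (fun v => i @^-1` @oc_set bX D v) setT s.
Proof. by rewrite -i_dense; exact: nerve_closure. Qed.

Definition cech_pair (D : open_cover bX) : nerve_pair A :=
  NervePair (@nerve_dense D) (@nerve_closure D A).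

Lemma cech_morP (D E : open_cover bX) (p : projection (@oc_set bX) D E) v :
  i @^-1` oc_set v `<=` i @^-1` oc_set (sval p v).
Proof. by move=> x; exact: (svalP p). Qed.

Definition cech_mor (D E : open_cover bX) (p : projection (@oc_set bX) D E) :
  refinement (cech_pair D) (cech_pair E) := exist _ (sval p) (cech_morP p).

Lemma projection_of_refines (D E : open_cover bX) :
  (forall U, oc_family E U -> exists2 W, oc_family D W & U `<=` W) ->
  inhabited (projection (@oc_set bX) D E).
Proof.
move=> ED; have /choice[p pP] (v : set_type (oc_family E)) :
    exists w : set_type (oc_family D), oc_set v `<=` oc_set w.
  have [W DW vW] := ED _ (set_valP v).
  by exists (exist _ W (mem_set DW)).
by constructor; exists p.
Qed.

(** Pairwise intersections refine both covers, but there may be infinitely many; a finite subcover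
    makes the refinement small. *)
Lemma cech_dir (D E : open_cover bX) :
  exists F (p : projection (@oc_set bX) D F) (q : projection (@oc_set bX) E F),
    finite_nerve (cech_pair F).
Proof.
pose C : set (set bX) := [set U | open U /\
  (exists2 W, oc_family D W & U `<=` W) /\ (exists2 W, oc_family E W & U `<=` W)].
have [||e eC ecov] := @finite_subcover bX C bX_compact.
- by move=> U [].
- move=> x; have [U DU Ux] : (\bigcup_(U in oc_family D) U) x by rewrite oc_setT.
  have [V EV Vx] : (\bigcup_(U in oc_family E) U) x by rewrite oc_setT.
  exists (U `&` V) => //; split; first exact: openI (oc_open DU) (oc_open EV).
  by split; [exists U|exists V] => //; move=> y [].
have eo U : [set` e] U -> open U by move=> /eC[].
have eT : \bigcup_(U in [set` e]) U = setT.
  by rewrite -subTset => x _; have [U eU Ux] := ecov x; exists U.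
pose F := OpenCover eo eT.
have [p] : inhabited (projection (@oc_set bX) D F).
  by apply: projection_of_refines => U /eC[_ []].
have [q] : inhabited (projection (@oc_set bX) E F).
  by apply: projection_of_refines => U /eC[_ []].
exists F, p, q; exists (pmap insub e) => v.
by rewrite mem_pmap_sub; exact: set_valP v.
Qed.

Definition cech_system : system (@refinement X A) (@finite_nerve X A) :=
  System cech_mor cech_dir.

Variable R : realType.
Hypothesis bX_hausdorff : hausdorff_space bX.
Hypothesis i_continuous : continuous i.

Lemma fo_cofinal : cofinal_in (fo_system R A) cech_system.
Proof.
move=> D; pose C : set (set bX) := [set U | functionally_open R U /\
  (exists2 W, oc_family D W & U `<=` W)].
have [||e eC ecov] := @finite_subcover bX C bX_compact.
- by move=> U [/functionally_open_open].
- move=> x; have [W DW Wx] : (\bigcup_(U in oc_family D) U) x by rewrite oc_setT.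
  have [U [fU UW] Ux] :=
    compact_functional_nbhs R bX_compact bX_hausdorff (oc_open DW) Wx.
  by exists U => //; split=> //; exists W.
pose U (k : 'I_(size e)) := i @^-1` nth set0 e k.
have eP (k : 'I_(size e)) : C (nth set0 e k) by apply: eC; exact: mem_nth.
have UP k : functionally_open R (U k).
  by apply: functionally_open_preimage => //; exact: (eP k).1.
have UT : \bigcup_k U k = setT.
  rewrite -subTset => x _; have [W eW Wx] := ecov (i x).
  have We : (index W e < size e)%N by rewrite index_mem.
  by exists (Ordinal We) => //; rewrite /U /= nth_index.
have /choice[p pP] (k : 'I_(size e)) :
    exists w : set_type (oc_family D), U k `<=` i @^-1` oc_set w.
  have [_ [W DW kW]] := eP k; exists (exist _ W (mem_set DW)) => x; exact: kW.
exists (FOCover UP UT); constructor; exists p; exact: pP.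
Qed.

Hypothesis i_extend : forall (K : topologicalType) (f : X -> K),
  compact [set: K] -> hausdorff_space K -> continuous f ->
  exists2 g : bX -> K, continuous g & forall x, g (i x) = f x.

(** The unit interval, taken as a space of its own, is compact Hausdorff; [f] is corestricted to it,
    extended, and included back into [R]. *)
Lemma extend_unit_interval (f : X -> R) : continuous f -> range f `<=` `[0, 1] ->
  exists2 g : bX -> R, continuous g & forall x, g (i x) = f x.
Proof.
move=> cf f01; pose I01 : set R := `[0, 1]%classic.
have fI x : f x \in I01 by apply/mem_set/f01; exists x.
have [||| g cg gE] := @i_extend I01 (fun x => exist _ (f x) (fI x)).
- exact/compact_set_type/segment_compact.
- exact/hausdorff_set_type/Rhausdorff.
- exact: continuous_set_type.
exists (set_val \o g) => [|x]; last by rewrite /= gE.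
by move=> x; apply: continuous_comp; [exact: cg|exact: initial_continuous].
Qed.

Lemma sum_continuous (T : topologicalType) (I : finType) (f : I -> T -> R) :
  (forall k, continuous (f k)) -> continuous (fun x => \sum_k f k x).
Proof.
move=> cf; rewrite -fct_sumE;
apply: (big_ind (fun g : T -> R => continuous g)) => // [x|g h cg ch x].
  exact: cvg_cst.
exact: (continuousD (cg x) (ch x)).
Qed.

Lemma cech_cofinal : cofinal_in cech_system (fo_system R A).
Proof.
move=> c; have /choice[f fP] := @fo_setP R X c.
have f0 k x : 0 <= f k x.
  by have [_ f01 _] := fP k; have /andP[] := range_unit f01 x.
pose sf x := \sum_k f k x.
have sf_gt0 x : 0 < sf x.
  have [k _] : (\bigcup_v @fo_set R X c v) x by rewrite fo_setT.
  have [_ _ ->] := fP k; rewrite /= in_itv/= => /andP[fk0 _].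
  by rewrite /sf (bigD1 k)//= ltr_pwDl// sumr_ge0.
(* The sum sf need not be bounded away from 0, so that the extensions of the f k
   may have common zeros in bX; those of the normalised functions have none. *)
pose phi k x := f k x / sf x.
have phi_cont k : continuous (phi k).
  move=> x; have [cf _ _] := fP k.
  have cs : {for x, continuous sf}.
    by apply: sum_continuous => l; have [] := fP l.
  exact: (continuousM (cf x) (continuousV (lt0r_neq0 (sf_gt0 x)) cs)).
have phi01 k : range (phi k) `<=` `[0, 1].
  move=> _ [x _ <-]; rewrite /= in_itv/= divr_ge0// ?(ltW (sf_gt0 x))//=.
  by rewrite ler_pdivrMr// mul1r /sf (bigD1 k)//= lerDl sumr_ge0.
have /choice[g gP] (k : 'I_(fo_size c)) : exists g : bX -> R,
    continuous g /\ forall x, g (i x) = phi k x.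
  by have [g] := extend_unit_interval (phi_cont k) (phi01 k); exists g.
(* The sum is 1 on the dense image of [X], and the set where it equals 1 is closed. *)
have g_sum z : \sum_k g k z = 1.
  have : closed [set z | \sum_k g k z = 1].
    apply: (@closed_comp _ _ (fun z => \sum_k g k z) [set 1]).
      by move=> y _; apply: sum_continuous => k; exact: (gP k).1.
    exact: closed_eq.
  move=> /closure_id E; suff : closure (range i) `<=` [set z | \sum_k g k z = 1].
    by rewrite i_dense; exact.
  rewrite E; apply: closure_subset => _ [x _ <-] /=.
  under eq_bigr do rewrite (gP _).2.
  by rewrite /phi -mulr_suml divff// lt0r_neq0//; exact: sf_gt0.
pose O k := g k @^-1` [set r | 0 < r].
have oO U : range O U -> open U.
  move=> [k _ <-]; apply: open_comp (@open_gt R 0) => z _; exact: (gP k).1.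
have OT : \bigcup_(U in range O) U = setT.
  rewrite -subTset => z _; apply: contrapT => nz.
  (* At a point outside every [O k] all summands would be nonpositive, against the sum being 1. *)
  have : \sum_k g k z <= 0.
    apply: sumr_le0 => k _; rewrite leNgt; apply/negP => gz.
    by apply: nz; exists (O k) => //; exists k.
  by rewrite g_sum ler10.
exists (OpenCover oO OT).
(* The open cover is indexed by its members, and several [k] may give the same set, so one [k] is
   chosen for each member. *)
have /choice[p pP] (v : set_type (range O)) :
    exists k : 'I_(fo_size c), i @^-1` set_val v `<=` fo_set k.
  have [k _ kv] := set_valP v; exists k => x.
  rewrite (_ : set_val v = O k)// /O /= (gP k).2 => phx.
  have [_ f01 ->] := fP k; have /andP[_ f1] := range_unit f01 x.
  rewrite /= in_itv/= f1 andbT.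
  by move: phx; rewrite /phi pmulr_lgt0// invr_gt0.
by constructor; exists p; exact: pP.
Qed.

End CechSystem.

(** The bonding maps of the limits and the maps of refinements have the same vertex map and differ
    only in the proofs that it is simplicial. *)
Lemma homology_map_irr (W V : choiceType) (G : zmodType) n (p : W -> V)
    (K' L' : scomplex W) (K L : scomplex V)
    (pK qK : forall s, K' s -> K [fset p v | v in s]%fset)
    (pL qL : forall s, L' s -> L [fset p v | v in s]%fset) :
  homology_map G n pK pL =1 homology_map G n qK qL.
Proof. by rewrite (Prop_irrelevance pK qK) (Prop_irrelevance pL qL). Qed.

Lemma cohomology_map_irr (W V : choiceType) (G : zmodType) n (p : W -> V)
    (K' L' : scomplex W) (K L : scomplex V)
    (pK qK : forall s, K' s -> K [fset p v | v in s]%fset)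
    (pL qL : forall s, L' s -> L [fset p v | v in s]%fset) :
  cohomology_map G n pK pL =1 cohomology_map G n qK qL.
Proof. by rewrite (Prop_irrelevance pK qK) (Prop_irrelevance pL qL). Qed.

Theorem theorem2p1 (R : realType) (X : topologicalType) (A : set X)
    (bX : topologicalType) (i : X -> bX) (G : zmodType) (n : int)
    (X_tychonoff : tychonoff_space X) (A_cc : completely_closed R A)
    (bX_stone_cech : stone_cech i) :
  zmod_isomorphic (functional_homology R A G n)
                  (cech_homology (closure (i @` A)) G n) /\
  zmod_isomorphic (functional_cohomology R A G n)
                  (cech_cohomology (closure (i @` A)) G n).
Proof.
have [cbX hbX [_ iop] dense ext] := bX_stone_cech.
have ci : continuous i.
  by apply/continuousP => W oW; apply/iop; exists W.
have fc := @fo_cofinal _ _ _ A dense cbX R hbX ci.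
have cf := @cech_cofinal _ _ _ A dense cbX R ext.
split.
  apply: (invlim_isomorphic (@refinement_homology_comp X A G n)
    (@refinement_homology_thin X A G n) _ _ fc cf) => [c d p|D E p] x.
    exact: homology_map_irr.
  exact: homology_map_irr.
apply: (dirlim_isomorphic (@refinement_cohomology_comp X A G n)
  (@refinement_cohomology_thin X A G n) _ _ fc cf) => [c d p|D E p] x.
  exact: cohomology_map_irr.
exact: cohomology_map_irr.
Qed.
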